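(* Let $X$ be a locally compact Hausdorff space that is not compact. Consider the statements: (i) $X$ is metrizable, locally Euclidean, and has no isolated points; (ii) $X$ is metrizable and $\operatorname{Homeo}_{\overline U}(X)$ is not locally compact for every non-empty open set $U$ such that $\overline U$ is compact; (iii) $X$ is normal, locally metrizable, and contains (1) a compact subset $M_0$ such that $\operatorname{Homeo}_{M_0}(X)$ is not locally compact, and (2) an infinite discrete closed set $T$ such that for every $t\in T$ and every neighborhood $V$ of $t$ with compact closure, $\operatorname{Homeo}_{\overline V}(X)$ is not discrete; (iv) $X$ contains (1) a compact metrizable subset $M_0$ such that $\operatorname{Homeo}_{M_0}(X)$ is not locally compact, and (2) a regular closed, $\sigma$-compact, metrizable subset $A$ whose interior contains an infinite discrete closed set $T$ such that for every $t\in T$ and every neighborhood $V$ of $t$ with compact closure, $\operatorname{Homeo}_{\overline V}(X)$ is not discrete; (v) the family $\{\operatorname{Homeo}_K(X)\}_{K\in\mathscr K(X)}$ does not satisfy ACP. Then (i) $\Rightarrow$ (ii) $\Rightarrow$ (iii) $\Rightarrow$ (iv) $\Rightarrow$ (v).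
   Context: A space is locally Euclidean if every point has an open neighborhood homeomorphic to $\mathbb R^n$ for some $n$. A subset is regular closed if it equals the closure of its interior. For a compact subset $K$ of $X$, $\operatorname{Homeo}_K(X)$ denotes the group of homeomorphisms $h$ of $X$ with $h(x)=x$ for all $x\in X\setminus K$, with the compact-open topology (a topological group). $\mathscr K(X)$ is the set of compact subsets of $X$ ordered by inclusion, and the family has inclusions as bonding maps. For a directed family $\{G_\alpha\}$ of topological groups with inclusions that are closed embeddings as bonding maps and union $G$, the colimit space topology is $\mathscr T=\{U\subseteq G\mid U\cap G_\alpha\text{ open in }G_\alpha\ \forall\alpha\}$; the family satisfies ACP if $(G,\mathscr T)$ is a topological group (equivalently, $\mathscr T$ equals the finest group topology making all inclusions continuous). *)

(* Defs.v *)
From HB Require Import structures.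
From mathcomp Require Import all_boot all_order all_algebra.
From mathcomp Require Import all_classical all_reals all_analysis.
From mathcomp Require Import Rstruct Rstruct_topology.
From Stdlib Require Rdefinitions.
Set Implicit Arguments. Unset Strict Implicit. Unset Printing Implicit Defensive.
Import Order.TTheory GRing.Theory Num.Theory.
Local Open Scope classical_set_scope.
Local Open Scope ring_scope.

Section Defs.
Context {X : topologicalType}.

Definition loc_compact_in {Y : topologicalType} (S : set Y) : Prop :=
  forall y, S y -> exists N : set Y,
    [/\ compact N, N `<=` S & exists O, [/\ open O, O y & O `&` S `<=` N]].

Definition discrete_in {Y : topologicalType} (S : set Y) : Prop :=
  forall y, S y -> exists O, open O /\ O `&` S = [set y].

Definition metrizable_on (A : set X) : Prop :=
  exists d : X -> X -> Rdefinitions.R,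
    [/\ (forall x y, A x -> A y -> 0 <= d x y),
        (forall x y, A x -> A y -> (d x y = 0 <-> x = y)),
        (forall x y, A x -> A y -> d x y = d y x),
        (forall x y z, A x -> A y -> A z -> d x z <= d x y + d y z) &
        (forall x, A x -> forall W : set X,
           (exists O, [/\ open O, O x & O `&` A `<=` W]) <->
           (exists e : Rdefinitions.R, 0 < e /\ [set y | A y /\ d x y < e] `<=` W))].

Definition metrizable : Prop := metrizable_on [set: X].

Definition locally_metrizable : Prop :=
  forall x : X, exists N, nbhs x N /\ metrizable_on N.

Definition locally_euclidean : Prop :=
  forall x : X, exists U : set X, open U /\ U x /\
    exists (n : nat) (f : X -> 'rV[Rdefinitions.R]_n) (g : 'rV[Rdefinitions.R]_n -> X),
      [/\ {within U, continuous f}, continuous g,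
          (forall v, U (g v)), (forall y, U y -> g (f y) = y) &
          (forall v, f (g v) = v)].

Definition isolated_point (x : X) : Prop := open [set x].

Definition discrete_set (T : set X) : Prop :=
  forall t, T t -> exists O, open O /\ O `&` T = [set t].

Definition regular_closed (A : set X) : Prop := closure (interior A) = A.

Definition sigma_compact (A : set X) : Prop :=
  exists K : nat -> set X, (forall n, compact (K n)) /\ A = \bigcup_n K n.

Definition homeomorphism (h : X -> X) : Prop :=
  continuous h /\ exists g : X -> X, [/\ continuous g, cancel h g & cancel g h].

Definition Homeo (K : set X) : set {compact-open, X -> X} :=
  [set h | homeomorphism h /\ forall x, ~ K x -> h x = x].

Definition HomeoC : set {compact-open, X -> X} :=
  [set h | exists K, compact K /\ Homeo K h].

Definition colim_open (U : set {compact-open, X -> X}) : Prop :=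
  U `<=` HomeoC /\
  forall K : set X, compact K ->
    exists O : set {compact-open, X -> X}, open O /\ U `&` Homeo K = O `&` Homeo K.

(** ACP: (G, colimit topology) is a topological group, i.e. inversion and
    multiplication (composition; the latter with the product topology on G x G)
    are continuous. *)
Definition ACP : Prop :=
  (forall U, colim_open U ->
     colim_open [set g | HomeoC g /\
        exists h : X -> X, [/\ U h, cancel g h & cancel h g]]) /\
  (forall U, colim_open U -> forall g h : {compact-open, X -> X},
     HomeoC g -> HomeoC h -> U (g \o h) ->
     exists V W, [/\ colim_open V, colim_open W, V g, W h &
       forall a b, V a -> W b -> U (a \o b)]).

End Defs.

(* Main.v *)
(* (i) => (ii): homeomorphisms supported in a small enough chart lie in any prescribed
   neighbourhood of the identity; conjugating the radial maps v / (1 + k (1 - |v|)) of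
   the unit ball by the chart gives a sequence of them collapsing the open ball pointwise
   to its centre, which therefore has no injective cluster point.

   (ii) => (iii) => (iv): a non-compact metrizable space contains a sequence without
   cluster point; normality spreads an infinite closed discrete set to a discrete family
   of metrizable compact neighbourhoods; metrics are glued with functions phi_i supported
   in metrizable pieces.

   (iv) => (v): let M = M0.  As Homeo_M(X) is metrizable but not locally compact, some f
   in it has all its closed balls B(f, 1/(n+1)) non-compact, so each contains a sequence
   (z_{n,k})_k without cluster point.  Choose compact neighbourhoods D_n of points of T,
   disjoint from M, only finitely many of which meet a given compact set, and
   homeomorphisms y_{n,k} <> id supported in D_n with y_{n,k} -> id as k -> oo.  The set
   of all z_{n,k} o y_{n,k} is closed in the colimit topology and omits f, yet every
   product of a neighbourhood of f and a neighbourhood of id meets it, so multiplication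
   is discontinuous at (f, id). *)

Require Import Defs.
From HB Require Import structures.
From mathcomp Require Import all_boot all_order all_algebra.
From mathcomp Require Import all_classical all_reals all_analysis.
From mathcomp Require Import Rstruct Rstruct_topology.
From mathcomp Require Import lra.
Set Implicit Arguments. Unset Strict Implicit. Unset Printing Implicit Defensive.
Import Order.TTheory GRing.Theory Num.Theory.
Import numFieldNormedType.Exports.
Local Open Scope classical_set_scope.
Local Open Scope ring_scope.

Local Notation R := Rdefinitions.R.

(** * Metrizable subsets *)

Section MetricOn.
Context {Y : topologicalType}.
Implicit Types (A S W : set Y) (d : Y -> Y -> R).

(** The body of [metrizable_on] with the metric exposed, so that one metric can be carried through
    several lemmas; nothing is asked of [d] off [A]. *)
Definition metric_on A d : Prop :=
  [/\ (forall x y, A x -> A y -> 0 <= d x y),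
      (forall x y, A x -> A y -> (d x y = 0 <-> x = y)),
      (forall x y, A x -> A y -> d x y = d y x),
      (forall x y z, A x -> A y -> A z -> d x z <= d x y + d y z) &
      (forall x, A x -> forall W : set Y,
         (exists V, [/\ open V, V x & V `&` A `<=` W]) <->
         (exists e : R, 0 < e /\ [set y | A y /\ d x y < e] `<=` W))].

Lemma metric_on_near A d x e : metric_on A d -> A x -> 0 < e ->
  \forall y \near x, A y -> d x y < e.
Proof.
move=> [_ _ _ _ dT] Ax e0.
have [_ H] := dT x Ax [set y | d x y < e]; have [|V [oV Vx VA]] := H.
  by exists e; split=> // y [].
by apply: filterS (open_nbhs_nbhs (conj oV Vx)) => y Vy Ay; apply: VA.
Qed.

Lemma metric_on_ball A d x W : metric_on A d -> A x -> nbhs x W ->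
  exists2 e : R, 0 < e & forall y, A y -> d x y < e -> W y.
Proof.
move=> [_ _ _ _ dT] Ax; rewrite nbhsE => -[V [oV Vx] VW].
have [H _] := dT x Ax W; have [|e [e0 eW]] := H.
  by exists V; split=> // y [/VW].
by exists e => // y Ay de; apply: eW.
Qed.

Lemma metric_onI A d :
  (forall x y, A x -> A y -> 0 <= d x y) ->
  (forall x y, A x -> A y -> (d x y = 0 <-> x = y)) ->
  (forall x y, A x -> A y -> d x y = d y x) ->
  (forall x y z, A x -> A y -> A z -> d x z <= d x y + d y z) ->
  (forall x e, A x -> 0 < e -> \forall y \near x, A y -> d x y < e) ->
  (forall x W, A x -> nbhs x W ->
     exists2 e : R, 0 < e & forall y, A y -> d x y < e -> W y) ->
  metric_on A d.
Proof.
move=> d0 d1 ds dt dn dW; split=> // x Ax W; split.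
  move=> [V [oV Vx VW]]; have [e e0 eV] := dW x V Ax (open_nbhs_nbhs (conj oV Vx)).
  by exists e; split=> // y [Ay /eV Vy]; apply: VW; split=> //; apply: Vy.
move=> [e [e0 eW]].
have : nbhs x [set y | A y -> d x y < e] by exact: dn.
rewrite nbhsE => -[V [oV Vx] Ve].
by exists V; split=> // y [Vy Ay]; apply: eW; split=> //; apply: Ve.
Qed.

Lemma metric_on_xx A d x : metric_on A d -> A x -> d x x = 0.
Proof. by move=> [_ d1 _ _ _] Ax; apply/d1. Qed.

Lemma metric_on_subset A B d : B `<=` A -> metric_on A d -> metric_on B d.
Proof.
move=> BA dA; have [d0 d1 ds dt _] := dA; apply: metric_onI.
- by move=> x y /BA Ax /BA Ay; apply: d0.
- by move=> x y /BA Ax /BA Ay; apply: d1.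
- by move=> x y /BA Ax /BA Ay; apply: ds.
- by move=> x y z /BA Ax /BA Ay /BA Az; apply: dt.
- move=> x e /BA Ax e0; apply: filterS (metric_on_near dA Ax e0) => y + /BA.
  exact.
- move=> x W /BA Ax xW; have [e e0 eW] := metric_on_ball dA Ax xW.
  by exists e => // y /BA; apply: eW.
Qed.

Lemma metrizable_on_subset A B : B `<=` A -> metrizable_on A -> metrizable_on B.
Proof. by move=> BA [d dA]; exists d; apply: metric_on_subset dA. Qed.

Lemma metrizable_on_bounded A : metrizable_on A ->
  exists2 d, metric_on A d & forall x y, d x y <= 1.
Proof.
move=> [d dA]; have [d0 d1 ds dt _] := dA.
have e1 x y : Num.min 1 (d x y) <= 1 by rewrite ge_min lexx.
exists (fun x y => Num.min 1 (d x y)) => //; apply: metric_onI.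
- by move=> x y Ax Ay; rewrite le_min ler01 d0.
- move=> x y Ax Ay; rewrite -d1//; split=> [|->]; last by rewrite min_r.
  by case: leP => // _ /eqP; rewrite oner_eq0.
- by move=> x y Ax Ay; rewrite ds.
- move=> x y z Ax Ay Az; have tri := dt _ _ _ Ax Ay Az.
  have xy0 := d0 _ _ Ax Ay; have yz0 := d0 _ _ Ay Az.
  by rewrite /Num.min; do 3!case: ltP => ?; lra.
- move=> x e Ax e0; apply: filterS (metric_on_near dA Ax e0) => y + Ay.
  by move=> /(_ Ay); rewrite gt_min orbC => ->.
- move=> x W Ax xW; have [e e0 eW] := metric_on_ball dA Ax xW.
  exists (Num.min 1 e); first by rewrite lt_min ltr01.
  move=> y Ay h; apply: eW => //; move: h.
  by rewrite /Num.min; case: (ltP 1 (d x y)) => ?; case: (ltP 1 e) => ? ?; lra.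
Qed.

(** The coordinates [F j] embed [A] into the bounded functions on [J] with the supremum norm, whose
    metric is pulled back. *)
Lemma metrizable_on_family A (J : Type) (F : J -> Y -> R) :
  (forall j x, A x -> 0 <= F j x <= 1) ->
  (forall x e, A x -> 0 < e ->
     \forall y \near x, A y -> forall j, `|F j x - F j y| <= e) ->
  (forall x W, A x -> nbhs x W -> exists2 e : R, 0 < e &
     forall y, A y -> (forall j, `|F j x - F j y| < e) -> W y) ->
  (forall x y, A x -> A y -> (forall j, F j x = F j y) -> x = y) ->
  metrizable_on A.
Proof.
move=> F01 Fc FW Finj.
(* Adjoining 0 keeps the set non-empty when [J] is empty. *)
pose E x y : set R := [set r | r = 0 \/ exists j, r = `|F j x - F j y|].
have E0 x y : E x y !=set0 by exists 0; left.
have Eub x y : A x -> A y -> ubound (E x y) 1.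
  move=> Ax Ay r [->//|[j ->]]; have := F01 j x Ax; have := F01 j y Ay.
  by rewrite ler_norml => *; lra.
have dF x y j : A x -> A y -> `|F j x - F j y| <= sup (E x y).
  move=> Ax Ay; apply: ub_le_sup; last by right; exists j.
  by exists 1; apply: Eub.
have d0 x y : A x -> A y -> 0 <= sup (E x y).
  by move=> Ax Ay; apply: ub_le_sup; [exists 1; apply: Eub|left].
have dle x y e : 0 <= e -> (forall j, `|F j x - F j y| <= e) -> sup (E x y) <= e.
  by move=> e0 Fe; apply: ge_sup => // r [->//|[j ->]].
exists (fun x y => sup (E x y)); apply: metric_onI => //.
- move=> x y Ax Ay; split=> [dxy|->].
    apply: Finj => // j; apply/eqP; rewrite -subr_eq0 -normr_le0 -dxy.
    exact: dF.
  apply/eqP; rewrite eq_le d0// andbT; apply: dle => // j.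
  by rewrite subrr normr0.
- move=> x y Ax Ay; congr sup; apply/funext => r; apply/propext.
  by split=> -[->|[j ->]]; [left|right; exists j; rewrite distrC
    |left|right; exists j; rewrite distrC].
- move=> x y z Ax Ay Az; apply: dle; first by rewrite addr_ge0 ?d0.
  move=> j; rewrite (le_trans (ler_distD (F j y) _ _))//.
  by rewrite lerD ?dF.
- move=> x e Ax e0; have e2 : 0 < e / 2 by lra.
  apply: filterS (Fc x _ Ax e2) => y + Ay => /(_ Ay) Fe.
  by apply: (@le_lt_trans _ _ (e / 2)); [apply: dle => //; lra|lra].
- move=> x W Ax xW; have [e e0 eW] := FW x W Ax xW.
  exists e => // y Ay de; apply: eW => // j.
  exact: le_lt_trans (dF _ _ _ _ _) de.
Qed.

(** No point of [A] is a cluster point of [u]. Quantifying over the pair of [y] and [n] matches the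
    near-covering form of compactness. *)
Definition escapes (u : nat -> Y) A :=
  forall x, A x -> \forall y \near x & n \near \oo, u n <> y.

Lemma escapes_compact u A : escapes u A -> compact A ->
  \forall n \near \oo, ~ A (u n).
Proof.
move=> uA /compact_near_coveringP/(_ _ \oo (fun n y => u n <> y) _ uA).
by apply: filterS => n An Aun; apply: (An _ Aun).
Qed.

Lemma metric_escapesPn A d u : metric_on A d -> (forall n, A (u n)) ->
  ~ escapes u A -> exists2 x, A x &
    forall e N, 0 < e -> exists2 n, (N <= n)%N & d x (u n) < e.
Proof.
move=> dA uA /existsNP[x /not_implyP[Ax]] nesc; exists x => // e N e0.
apply: contrapT => H; apply: nesc.
exists ([set y | A y -> d x y < e], [set n | (N <= n)%N]).
  by split; [exact: metric_on_near|exists N].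
move=> [y n] [/= ye Nn] uny; apply: H; exists n => //.
by rewrite uny; apply: ye; rewrite -uny.
Qed.

Lemma metric_separated_sequence A d e :
  (forall s : seq Y, (forall x, x \in s -> A x) ->
     exists2 y, A y & forall x, x \in s -> e <= d x y) ->
  exists u : nat -> Y, (forall n, A (u n)) /\
    forall i n, (i < n)%N -> e <= d (u i) (u n).
Proof.
move=> H.
have /choice[f fP] : forall s : seq Y, exists y,
    (forall x, x \in s -> A x) -> A y /\ forall x, x \in s -> e <= d x y.
  move=> s; have [sA|sA] := pselect (forall x, x \in s -> A x).
    by have [y Ay sy] := H s sA; exists y.
  by have [//|y _ _] := H [::]; exists y.
(* [s n] lists the first [n] terms; [f] adds a point far from all of them. *)
pose s := fix s n := if n is m.+1 then f (s m) :: s m else [::].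
have sA n x : x \in s n -> A x.
  elim: n x => [//|n IH] x /=; rewrite inE => /orP[/eqP->|/IH//].
  by have [] := fP _ IH.
exists (fun n => f (s n)); split=> [n|i n in_].
  by have [] := fP _ (sA n).
have [_] := fP _ (sA n); apply.
elim: n in_ => // n IH; rewrite ltnS leq_eqVlt => /orP[/eqP->|/IH].
  by rewrite /= inE eqxx.
by move=> h; rewrite /= inE h orbT.
Qed.

(** Otherwise the complements of the finitely many [B x] all belong to the ultrafilter, and their
    intersection misses [A]. *)
Lemma ultra_seq_cover (F : set_system Y) (B : Y -> set Y) (s : seq Y) A :
  UltraFilter F -> F A -> (forall y, A y -> exists2 x, x \in s & B x y) ->
  exists2 x, x \in s & F (B x).
Proof.
move=> FU FA cov; apply: contrapT => H.
have [y [Ay yB]] : A `&` [set y | forall x, x \in s -> ~ B x y] !=set0.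
  apply: (@filter_ex _ F); apply: filterI => //.
  have {H} : forall x, x \in s -> F (~` B x).
    move=> x xs; have [FB|//] := in_ultra_setVsetC (B x) FU.
    by exfalso; apply: H; exists x.
  elim: s {cov} => [_|a s IH Fs].
    rewrite (_ : mkset _ = setT); first exact: filterT.
    by apply/seteqP; split=> // y _ x; rewrite in_nil.
  have Fa : F (~` B a) by apply: Fs; rewrite inE eqxx.
  have Fs' : F [set y | forall x, x \in s -> ~ B x y].
    by apply: IH => x xs; apply: Fs; rewrite inE xs orbT.
  apply: filterS (filterI Fa Fs') => y [ya ys] x.
  by rewrite inE => /orP[/eqP->|/ys].
by have [x xs xy] := cov y Ay; apply: (yB x).
Qed.

(** If no sequence escapes, [A] is totally bounded, since a separated sequence would escape. An
    ultrafilter on [A] then contains a ball of each radius 1/(n+1), and it converges to a cluster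
    point of the centres. *)
Lemma noncompact_escapes A : metrizable_on A -> ~ compact A ->
  exists2 u, forall n, A (u n) & escapes u A.
Proof.
move=> [d dA] ncA; apply: contrapT => H; apply: ncA.
have [d0 d1 ds dt _] := dA.
have cl u : (forall n, A (u n)) -> exists2 x, A x &
    forall e N, 0 < e -> exists2 n, (N <= n)%N & d x (u n) < e.
  move=> uA; apply: metric_escapesPn => // ue; apply: H.
  by exists u.
have tb e : 0 < e -> exists s : seq Y, (forall x, x \in s -> A x) /\
    forall y, A y -> exists2 x, x \in s & d x y < e.
  move=> e0; apply: contrapT => nb.
  have [|u [uA us]] := @metric_separated_sequence A d e.
    move=> s sA; apply: contrapT => ns; apply: nb; exists s; split=> // y Ay.
    apply: contrapT => ny; apply: ns; exists y => // x xs.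
    by rewrite leNgt; apply/negP => xy; apply: ny; exists x.
  have [x Ax xu] := cl u uA.
  have e2 : 0 < e / 2 by lra.
  have [i _ ui] := xu _ 0%N e2; have [j ij uj] := xu _ i.+1 e2.
  have := us _ _ ij; have := dt _ _ _ (uA i) Ax (uA j).
  by rewrite (ds _ x)// => *; lra.
rewrite compact_ultra => F FU FA.
have /choice[u uP] : forall n : nat, exists x,
    A x /\ F [set y | A y /\ d x y < n.+1%:R^-1].
  move=> n; have n0 : 0 < n.+1%:R^-1 :> R by rewrite invr_gt0.
  have [s [sA cov]] := tb _ n0.
  have [|x xs Fx] := @ultra_seq_cover F
      (fun x => [set y | A y /\ d x y < n.+1%:R^-1]) s A FU FA.
    by move=> y Ay; have [x xs xy] := cov y Ay; exists x.
  by exists x; split=> //; apply: sA.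
have [x Ax xu] := cl u (fun n => (uP n).1).
exists x; split=> // W xW; have [e e0 eW] := metric_on_ball dA Ax xW.
have e2 : 0 < e / 2 by lra.
have [N _ NP] := near_infty_natSinv_lt (PosNum e2).
have [n Nn xun] := xu _ N e2.
have [Aun Fun] := uP n.
apply: filterS Fun => y [Ay uny]; apply: eW => //.
have n2 := NP n Nn; rewrite /= in n2.
apply: le_lt_trans (dt _ _ _ Ax Aun Ay) _.
by rewrite (splitr e) ltrD// (lt_trans uny).
Qed.

(** Each point gets half of a radius that keeps it away from the other closed set; by the triangle
    inequality two such balls around points of different sets cannot meet. *)
Lemma metrizable_normal : @metrizable Y -> normal_space Y.
Proof.
move=> [d dA]; apply/(@normal_openP R) => A B cA cB AB0.
have [d0 _ ds dt _] := dA.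
have sep (C D : set Y) : closed D -> C `&` D = set0 -> exists r : Y -> R,
    forall x, C x -> 0 < r x /\ forall y, D y -> r x <= d x y.
  move=> cD CD0; suff /choice[r rP] : forall x, exists e : R,
      C x -> 0 < e /\ forall y, D y -> e <= d x y by exists r.
  move=> x.
  have [Cx|nCx] := pselect (C x); last by exists 0.
  have xD : nbhs x (~` D).
    apply: open_nbhs_nbhs; split; first exact: closed_openC.
    by move=> Dx; suff: set0 x by []; rewrite -CD0.
  have [e e0 eD] := metric_on_ball dA (I : [set: Y] x) xD.
  exists e => _; split=> // y Dy; rewrite leNgt; apply/negP => xy.
  exact: eD xy Dy.
have [r rP] := sep A B cB AB0.
have [s sP] : exists s : Y -> R,
    forall x, B x -> 0 < s x /\ forall y, A y -> s x <= d x y.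
  by apply: sep => //; rewrite setIC.
(* Balls are only known to be neighbourhoods of their centres, hence the interiors. *)
pose U (C : set Y) (q : Y -> R) : set Y :=
  \bigcup_(x in C) [set y | d x y < q x / 2]°.
have CU C q : (forall x, C x -> 0 < q x) -> C `<=` U C q.
  move=> qC x Cx; exists x => //; have q0 : 0 < q x / 2 by have := qC x Cx; lra.
  by apply: filterS (metric_on_near dA (I : [set: Y] x) q0) => y; apply.
exists (U A r), (U B s); split.
- by apply: bigcup_open => x _; exact: open_interior.
- by apply: bigcup_open => x _; exact: open_interior.
- by apply: CU => x /rP[].
- by apply: CU => x /sP[].
rewrite -subset0 => y [[a Aa /interior_subset/= ya] [b Bb /interior_subset/= yb]].
have [_ /(_ b Bb) rab] := rP a Aa; have [_ /(_ a Aa) sba] := sP b Bb.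
have tri := dt a y b I I I; rewrite (ds y b)// in tri.
by rewrite (ds b a)// in sba; clear -rab sba ya yb tri; lra.
Qed.

End MetricOn.

(** * The compact-open topology on homeomorphisms with compact support *)

Section CompactOpen.
Context {X : topologicalType}.
Implicit Types (K M U V W : set X) (f g h : {compact-open, X -> X}).

Lemma compact_open_nbhs f K V : compact K -> open V -> f @` K `<=` V ->
  nbhs f [set g : {compact-open, X -> X} | g @` K `<=` V].
Proof.
by move=> cK oV fKV; apply: open_nbhs_nbhs; split=> //; exact: compact_open_open.
Qed.

Lemma compact_open_eval f (x : X) V : nbhs (f x) V ->
  nbhs f [set g : {compact-open, X -> X} | V (g x)].
Proof.
rewrite nbhsE => -[V' [oV' V'f] V'V].
have : nbhs f [set g : {compact-open, X -> X} | g @` [set x] `<=` V'].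
  apply: compact_open_nbhs => //; first exact: compact_set1.
  by move=> _ [_ -> <-].
by apply: filterS => g gV; apply: V'V; apply: gV; exists x.
Qed.

Lemma Homeo_inj K h : Homeo K h -> injective h.
Proof. by move=> [[_ [g [_ hK _]]] _]; exact: can_inj hK. Qed.

Lemma Homeo_continuous K h : Homeo K h -> continuous (h : X -> X).
Proof. by move=> [[]]. Qed.

(** If [h x] lay outside [K] it would be fixed, and injectivity would give [h x = x]. *)
Lemma Homeo_stable K h x : Homeo K h -> K x -> K (h x).
Proof.
move=> hK Kx; apply: contrapT => nKhx.
by apply: (nKhx); rewrite (Homeo_inj hK (hK.2 _ nKhx)).
Qed.

Lemma Homeo_subset K M : K `<=` M -> Homeo K `<=` Homeo M.
Proof. by move=> KM h [hh hK]; split=> // x nMx; apply: hK => /KM. Qed.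

Lemma Homeo_id K : Homeo K id.
Proof.
split=> //; split; first by move=> x; exact: cvg_id.
by exists id; split=> // x; exact: cvg_id.
Qed.

Lemma Homeo_comp K f g : Homeo K f -> Homeo K g -> Homeo K (f \o g).
Proof.
move=> [[cf [f' [cf' ff' f'f]]] fK] [[cg [g' [cg' gg' g'g]]] gK].
split; last by move=> x nKx /=; rewrite gK// fK.
split; first by move=> x; apply: continuous_comp; [exact: cg|exact: cf].
exists (g' \o f'); split.
- by move=> x; apply: continuous_comp; [exact: cf'|exact: cg'].
- exact: can_comp.
- exact: can_comp.
Qed.

Lemma Homeo_inverse K f : Homeo K f ->
  exists g, [/\ Homeo K g, cancel f g & cancel g f].
Proof.
move=> [[cf [f' [cf' ff' f'f]]] fK]; exists f'; split=> //; split.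
  by split=> //; exists f; split.
by move=> x nKx; rewrite -{1}(fK x nKx) ff'.
Qed.

Lemma compact_open_comp_cvg (F : set_system {compact-open, X -> X}) f g :
  Filter F -> continuous (g : X -> X) -> F --> f ->
  ((g \o h : {compact-open, X -> X}) @[h --> F]) --> (g \o f : {compact-open, X -> X}).
Proof.
move=> FF cg /compact_open_cvgP Ff; apply/compact_open_cvgP => K V cK oV gfV.
have oV' : open (g @^-1` V) by apply: open_comp => // x _; exact: cg.
have FK : F [set h : {compact-open, X -> X} | h @` K `<=` g @^-1` V].
  by apply: Ff => // _ [x Kx <-]; apply: gfV; exists x.
by move: FK; apply: (@filterS _ F) => h hV _ [x Kx <-]; apply: hV; exists x.
Qed.

Hypothesis hX : hausdorff_space X.

(** Maps carried by shrinking neighbourhoods of [x] converge to the identity. Stated as convergence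
    of a filter, this has to be checked for only one compact set and one open set at a time. *)
Lemma compact_open_supported (N : set {compact-open, X -> X}) (x : X) :
  nbhs (id : {compact-open, X -> X}) N -> exists2 W, nbhs x W &
    forall h, (forall y, ~ W y -> h y = y) -> (forall y, W y -> W (h y)) -> N h.
Proof.
move=> idN.
pose B W : set {compact-open, X -> X} :=
  [set h | (forall y, ~ W y -> h y = y) /\ (forall y, W y -> W (h y))].
pose F := filter_from (nbhs x) B.
have FF : Filter F.
  apply: filter_from_filter; first by exists setT; exact: filterT.
  move=> U V xU xV; exists (U `&` V); first exact: filterI.
  move=> h [hid hUV]; split; split=> y.
  - by move=> nUy; apply: hid => -[].
  - move=> Uy; have [Vy|nVy] := pselect (V y); first by have [] := hUV y (conj Uy Vy).
    by rewrite hid// => -[].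
  - by move=> nUy; apply: hid => -[].
  - move=> Vy; have [Uy|nUy] := pselect (U y); first by have [] := hUV y (conj Uy Vy).
    by rewrite hid// => -[].
suff /(_ N idN)[W xW WN] : F --> (id : {compact-open, X -> X}).
  by exists W => // h h1 h2; apply: WN.
apply/compact_open_cvgP => K V cK oV KV.
have {}KV y : K y -> V y by move=> Ky; apply: KV; exists y.
(* If [x] lies in [K], invariance of [V] suffices; otherwise the support is kept off [K], which is
   closed. *)
have [Kx|nKx] := pselect (K x).
  exists V; first by apply: open_nbhs_nbhs; split=> //; exact: KV.
  by move=> h [_ hV] _ [y Ky <-]; apply: hV; exact: KV.
exists (~` K).
  apply: open_nbhs_nbhs; split=> //; apply: closed_openC.
  exact: compact_closed.
by move=> h [hid _] _ [y Ky <-]; rewrite hid; [exact: KV|].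
Qed.

Hypothesis lcX : loc_compact_in [set: X].

Lemma compact_nbhs_inside (x : X) W : nbhs x W ->
  exists K, [/\ nbhs x K, compact K, closed K & K `<=` W].
Proof.
move=> xW; have [N [cN _ [V [oV Vx VN]]]] := lcX (I : [set: X] x).
have xN : nbhs x N by rewrite nbhsE; exists V => // y Vy; apply: VN.
have [C xC CW] := compact_regular hX cN xN xW.
exists (N `&` closure C); split.
- by apply: filterI => //; apply: filterS xC; exact: subset_closure.
- by apply: compact_closedI => //; exact: closed_closure.
- by apply: closedI; [exact: compact_closed|exact: closed_closure].
- by move=> y [_ /CW].
Qed.

(** One half of the fact that [Homeo M] carries the topology of [d]-uniform convergence on [M]. By
    compactness of [M] it suffices to control a compact neighbourhood of a single point, which [f]
    and nearby maps send within e/2 of the image of that point. *)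
Lemma Homeo_near_uniform M d f e : compact M -> metric_on M d ->
  Homeo M f -> 0 < e ->
  \forall g \near f, Homeo M g -> forall x, M x -> d (f x) (g x) < e.
Proof.
move=> cM dM fM e0; have [_ _ ds dt _] := dM.
have /compact_near_coveringP/near_covering_withinP cov := cM.
have H : \forall g \near f, M `<=` (fun x => Homeo M g -> d (f x) (g x) < e).
  apply: (cov _ (nbhs f) (fun g x => Homeo M g -> d (f x) (g x) < e)) => x Mx.
  have Mfx := Homeo_stable fM Mx.
  have e2 : 0 < e / 2 by lra.
  have : nbhs (f x) [set y | M y -> d (f x) y < e / 2] by exact: metric_on_near.
  rewrite nbhsE => -[V [oV Vfx] Vd].
  have : nbhs x (f @^-1` V) by apply: (Homeo_continuous fM); exact: open_nbhs_nbhs.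
  move=> /compact_nbhs_inside[K [xK cK _ KV]].
  exists (K, [set g : {compact-open, X -> X} | g @` K `<=` V]).
    split=> //; apply: compact_open_nbhs => //.
    by move=> _ [y Ky <-]; apply: KV.
  move=> [y g] [/= Ky gV] My gM.
  have Mfy := Homeo_stable fM My; have Mgy := Homeo_stable gM My.
  have fy := Vd _ (KV _ Ky) Mfy.
  have gy : d (f x) (g y) < e / 2 by apply: (Vd _ _ Mgy); apply: gV; exists y.
  have := dt _ _ _ Mfy Mfx Mgy; rewrite (ds (f y) (f x))// => tri.
  by clear -fy gy tri; lra.
by apply: filterS H => g H gM x Mx; apply: H.
Qed.

(** The other half. A Lebesgue-number argument on the part of a compact set inside [M] gives the
    radius; off [M] both maps are the identity. *)
Lemma Homeo_uniform_near M d f (N : set {compact-open, X -> X}) :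
  compact M -> metric_on M d -> Homeo M f -> nbhs f N ->
  exists2 e, 0 < e & forall g, Homeo M g ->
    (forall x, M x -> d (f x) (g x) < e) -> N g.
Proof.
move=> cM dM fM fN; have [_ _ ds dt _] := dM.
pose B e : set {compact-open, X -> X} :=
  [set g | Homeo M g /\ forall x, M x -> d (f x) (g x) < e].
pose F := filter_from [set e : R | 0 < e] B.
have FF : Filter F.
  apply: filter_from_filter; first by exists 1; exact: ltr01.
  move=> a b a0 b0; exists (Num.min a b); first by rewrite /= lt_min; apply/andP.
  by move=> g [gM ge]; split; split=> // x /ge; rewrite lt_min => /andP[].
suff /(_ N fN)[e e0 eN] : F --> f by exists e => // g gM ge; apply: eN.
apply/compact_open_cvgP => K V cK oV fKV.
have {}fKV y : K y -> V (f y) by move=> Ky; apply: fKV; exists y.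
have /compact_near_coveringP/near_covering_withinP cov : compact (K `&` M).
  by apply: compact_closedI => //; exact: compact_closed.
have H : \forall e \near 0^'+, K `&` M `<=`
    (fun x => forall y, M y -> d (f x) y < e -> V y).
  apply: (cov _ 0^'+ (fun e x => forall y, M y -> d (f x) y < e -> V y)).
  move=> x [Kx Mx]; have Mfx := Homeo_stable fM Mx.
  have [e e0 eV] := metric_on_ball dM Mfx (open_nbhs_nbhs (conj oV (fKV _ Kx))).
  have e2 : 0 < e / 2 by lra.
  exists ([set y | M (f y) -> d (f x) (f y) < e / 2], [set a | a < e / 2]).
    split; last exact: nbhs_right_lt.
    exact: (Homeo_continuous fM (metric_on_near dM Mfx e2)).
  move=> [x' a] [/= x'e ae] [_ Mx'] y My yd; have Mfx' := Homeo_stable fM Mx'.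
  apply: eV => //; have xx' := x'e Mfx'; have := dt _ _ _ Mfx Mfx' My => tri.
  by clear -xx' tri yd ae; lra.
have [e [e0 eH]] : exists e, 0 < e /\ K `&` M `<=`
    (fun x => forall y, M y -> d (f x) y < e -> V y).
  by apply: (@filter_ex _ (0^'+ : set_system R)); apply: filterI H; exact: nbhs_right_gt.
exists e => // g [gM ge] _ [x Kx <-].
have [Mx|nMx] := pselect (M x).
  exact: (eH x (conj Kx Mx) _ (Homeo_stable gM Mx) (ge x Mx)).
by rewrite gM.2// -(fM.2 x nMx); exact: fKV.
Qed.

(** The coordinates are the functions sending [f] to [d (f x) y] with [x], [y] in [M]; the choice
    [y = f x] recovers the uniform distance. *)
Lemma metrizable_on_Homeo M : compact M -> metrizable_on M ->
  metrizable_on (Homeo M).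
Proof.
move=> cM /metrizable_on_bounded[d dM d1]; have [d0 dd ds dt _] := dM.
pose F (j : {x | M x} * {x | M x}) (f : {compact-open, X -> X}) :=
  d (f (sval j.1)) (sval j.2).
apply: (@metrizable_on_family _ _ _ F).
- move=> [[x Mx] [y My]] f fM; rewrite /F /= d1 d0//.
  exact: (Homeo_stable fM Mx).
- move=> f e fM e0; apply: filterS (Homeo_near_uniform cM dM fM e0) => g H gM.
  move=> [[x Mx] [y My]]; rewrite /F /=.
  have Mfx := Homeo_stable fM Mx; have Mgx := Homeo_stable gM Mx.
  have de := H gM x Mx.
  have t1 := dt _ _ _ Mfx Mgx My; have t2 := dt _ _ _ Mgx Mfx My.
  rewrite (ds (g x) (f x))// in t2; rewrite ler_norml.
  by clear -de t1 t2; lra.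
- move=> f W fM fW; have [e e0 eW] := Homeo_uniform_near cM dM fM fW.
  exists e => // g gM H; apply: eW => // x Mx.
  have Mfx := Homeo_stable fM Mx; have Mgx := Homeo_stable gM Mx.
  have := H (exist _ x Mx, exist _ (f x) Mfx); rewrite /F /=.
  rewrite (metric_on_xx dM Mfx) sub0r normrN ds//; exact: le_lt_trans (ler_norm _).
- move=> f g fM gM H; apply/funext => x.
  have [Mx|nMx] := pselect (M x); last by rewrite fM.2// gM.2.
  have Mfx := Homeo_stable fM Mx; have Mgx := Homeo_stable gM Mx.
  have := H (exist _ x Mx, exist _ (f x) Mfx); rewrite /F /=.
  by rewrite (metric_on_xx dM Mfx) => /esym/dd => /(_ Mgx Mfx).
Qed.

End CompactOpen.

(** * Charts *)

Section RadialContraction.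
Context {V : normedModType R}.
Implicit Types (k : nat) (v : V).

(** Truncating the norm at 1 makes the scaling factors below equal to 1 outside the unit ball. *)
Let m v : R := Num.min 1 `|v|.

Definition shrink k v : V := (1 + k%:R * (1 - m v))^-1 *: v.
(** Solving s = t / (1 + k (1 - t)) for t gives t = (1 + k) s / (1 + k s). *)
Definition unshrink k v : V := ((1 + k%:R) / (1 + k%:R * m v)) *: v.

Let m_ge0 v : 0 <= m v. Proof. by rewrite /m le_min ler01 normr_ge0. Qed.
Let m_le1 v : m v <= 1. Proof. by rewrite /m ge_min lexx. Qed.

Let den1 k v : 0 < 1 + k%:R * (1 - m v).
Proof. by rewrite ltr_wpDr// mulr_ge0// subr_ge0. Qed.

Let den2 k v : 0 < 1 + k%:R * m v.
Proof. by rewrite ltr_wpDr// mulr_ge0. Qed.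

Let m_continuous : continuous m.
Proof.
move=> v; apply: (@continuous_min R V (cst 1) (fun v => `|v|)).
  exact: cvg_cst.
exact: norm_continuous.
Qed.

Lemma shrink_continuous k : continuous (shrink k).
Proof.
move=> v; apply: cvgZ; last exact: cvg_id.
apply: cvgV; first by rewrite gt_eqF.
apply: cvgD; first exact: cvg_cst.
apply: cvgM; first exact: cvg_cst.
by apply: cvgB; [exact: cvg_cst|exact: m_continuous].
Qed.

Lemma unshrink_continuous k : continuous (unshrink k).
Proof.
move=> v; apply: cvgZ; last exact: cvg_id.
apply: cvgM; first exact: cvg_cst.
apply: cvgV; first by rewrite gt_eqF.
apply: cvgD; first exact: cvg_cst.
by apply: cvgM; [exact: cvg_cst|exact: m_continuous].
Qed.

Lemma shrink_far k v : 1 <= `|v| -> shrink k v = v.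
Proof. by move=> v1; rewrite /shrink /m min_l// subrr mulr0 addr0 invr1 scale1r. Qed.

Lemma unshrink_far k v : 1 <= `|v| -> unshrink k v = v.
Proof. by move=> v1; rewrite /unshrink /m min_l// mulr1 divff ?scale1r// nat1r. Qed.

Lemma shrinkK k : cancel (shrink k) (unshrink k).
Proof.
move=> v; have [v1|v1] := leP 1 `|v|; first by rewrite shrink_far// unshrink_far.
have mv : m v = `|v| by rewrite /m min_r// ltW.
have k0 : 0 <= k%:R :> R by [].
have d1 := den1 k v; rewrite mv in d1.
pose c := (1 + k%:R * (1 - `|v|))^-1.
have c0 : 0 < c by rewrite invr_gt0.
have cE : c * (1 + k%:R * (1 - `|v|)) = 1 by rewrite mulVf// gt_eqF.
have ct : c * `|v| <= 1.
  have kv : 0 <= k%:R * (1 - `|v|) by rewrite mulr_ge0// subr_ge0 ltW.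
  by rewrite ler_pdivrMl// mulr1 (le_trans (ltW v1))// lerDl.
have sE : shrink k v = c *: v by rewrite /shrink mv.
have ms : m (shrink k v) = c * `|v| by rewrite /m sE normrZ gtr0_norm// min_r.
have d2 := den2 k (shrink k v); rewrite ms in d2.
rewrite /unshrink ms sE scalerA -[RHS]scale1r; congr (_ *: _).
have H : (1 + k%:R) * c = 1 + k%:R * (c * `|v|) by lra.
by rewrite mulrAC H divff// gt_eqF.
Qed.

Lemma unshrinkK k : cancel (unshrink k) (shrink k).
Proof.
move=> v; have [v1|v1] := leP 1 `|v|; first by rewrite unshrink_far// shrink_far.
have mv : m v = `|v| by rewrite /m min_r// ltW.
have k0 : 0 <= k%:R :> R by [].
have d2 := den2 k v; rewrite mv in d2.
pose c := (1 + k%:R) / (1 + k%:R * `|v|).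
have k1 : 0 < 1 + k%:R :> R by rewrite ltr_wpDr.
have c0 : 0 < c by rewrite divr_gt0.
have cE : c * (1 + k%:R * `|v|) = 1 + k%:R by rewrite divfK// gt_eqF.
have ct : c * `|v| <= 1.
  rewrite /c mulrAC ler_pdivrMr// mul1r mulrDl mul1r lerD2r.
  exact: ltW.
have sE : unshrink k v = c *: v by rewrite /unshrink mv.
have ms : m (unshrink k v) = c * `|v| by rewrite /m sE normrZ gtr0_norm// min_r.
have d1 := den1 k (unshrink k v); rewrite ms in d1.
rewrite /shrink ms sE scalerA -[RHS]scale1r; congr (_ *: _).
have H : 1 + k%:R * (1 - c * `|v|) = c by lra.
by rewrite H mulVf// gt_eqF.
Qed.

Lemma shrink_cvg0 v : `|v| < 1 -> shrink k v @[k --> \oo] --> 0.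
Proof.
move=> v1; have mv : m v = `|v| by rewrite /m min_r// ltW.
have c0 : 0 < 1 - `|v| by rewrite subr_gt0.
apply/cvgr0Pnorm_lt => e e0.
(* Once (k + 1) e (1 - |v|) > 1, also e (1 + k (1 - |v|)) > 1 > |v|. *)
have ce : 0 < e * (1 - `|v|) by rewrite mulr_gt0.
apply: filterS (near_infty_natSinv_lt (PosNum ce)) => k /= ke.
have d1 := den1 k v; rewrite mv in d1.
rewrite /shrink normrZ mv gtr0_norm ?invr_gt0// ltr_pdivrMl//.
rewrite invf_plt ?posrE// -div1r ltr_pdivrMr// in ke.
apply: (lt_le_trans v1); apply: (le_trans (ltW ke)).
rewrite mulrCA [leRHS]mulrC ler_wpM2l// ?(ltW e0)//.
by have v0 : 0 <= `|v| := normr_ge0 v; rewrite -nat1r; lra.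
Qed.

End RadialContraction.

Lemma affine_continuous (V : normedModType R) (a : V) (r : R) :
  continuous (fun v : V => a + r *: v).
Proof.
by move=> v; apply: cvgD; [exact: cvg_cst|apply: cvgZ; [exact: cvg_cst|exact: cvg_id]].
Qed.

Lemma sub_scale_continuous (V : normedModType R) (a : V) (r : R) :
  continuous (fun v : V => r *: (v - a)).
Proof.
by move=> v; apply: cvgZ; [exact: cvg_cst|apply: cvgB; [exact: cvg_id|exact: cvg_cst]].
Qed.

(** * Transport of such homeomorphisms along a chart *)

Section Charts.
Context {X : topologicalType} {n : nat}.
Local Notation V := 'rV[R]_n.
Implicit Types (E W : set X) (f : X -> V) (g : V -> X) (phi : V -> V).

(** As [E] is open, continuity of [f] on it can be stated pointwise instead of in the subspace. *)
Definition chart E f g : Prop :=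
  continuous g /\
  [/\ open E, (forall y, E y -> {for y, continuous f}),
      (forall v, E (g v)), (forall y, E y -> g (f y) = y) & forall v, f (g v) = v].

(** The coordinates are recentred at [f x] and rescaled by e/2, where [g] sends the e-ball around
    [f x] into [W]; halving fits the closed unit ball into that open ball. *)
Lemma chart_rescale E f g (x : X) W : chart E f g -> E x -> nbhs x W ->
  exists f' g', chart E f' g' /\ forall v, `|v| <= 1 -> W (g' v).
Proof.
move=> [cg [oE cf Eg gf fg]] Ex xW.
have : nbhs (f x) (g @^-1` W) by apply: cg; rewrite gf.
move=> /nbhs_normP[e /= e0 eW].
have r0 : e / 2 != 0 by rewrite gt_eqF// divr_gt0.
exists (fun y => (e / 2)^-1 *: (f y - f x)), (fun v => g (f x + (e / 2) *: v)).
split; last first.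
- move=> v v1; apply: eW; rewrite /ball_/= opprD addrA subrr sub0r normrN normrZ.
  rewrite gtr0_norm ?divr_gt0//; apply: (@le_lt_trans _ _ (e / 2 * 1)).
    by rewrite ler_wpM2l// ltW// divr_gt0.
  by rewrite mulr1; lra.
split.
  move=> v; have H := @affine_continuous _ (f x) (e / 2 : R) (v : V).
  exact: (@continuous_comp _ _ _ (fun w : V => f x + (e / 2 : R) *: w) g v H (cg _)).
split=> //.
- move=> y Ey; apply: (@continuous_comp _ _ _ f (fun v => (e / 2)^-1 *: (v - f x))).
    exact: cf.
  exact: sub_scale_continuous.
- by move=> y Ey; rewrite scalerA divff// scale1r addrC subrK gf.
- by move=> v; rewrite fg addrAC subrr add0r scalerA mulVf// scale1r.
Qed.

Definition chart_lift E f g phi (y : X) : X := if `[< E y >] then g (phi (f y)) else y.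

Lemma chart_lift_in E f g phi y : E y -> chart_lift E f g phi y = g (phi (f y)).
Proof. by move=> Ey; rewrite /chart_lift asboolT. Qed.

Lemma chart_lift_out E f g phi y : ~ E y -> chart_lift E f g phi y = y.
Proof. by move=> Ey; rewrite /chart_lift asboolF. Qed.

Lemma chart_lift_far E f g phi y : chart E f g ->
  (forall v, 1 <= `|v| -> phi v = v) ->
  ~ (g @` [set v | `|v| <= 1]) y -> chart_lift E f g phi y = y.
Proof.
move=> [_ [_ _ _ gf _]] phi1 ny.
have [Ey|nEy] := pselect (E y); last by rewrite chart_lift_out.
rewrite chart_lift_in// phi1 ?gf//; have [//|/ltW fy] := leP 1 `|f y|.
by exfalso; apply: ny; exists (f y) => //; exact: gf.
Qed.

Lemma chart_liftK E f g phi phi' : chart E f g -> cancel phi phi' ->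
  cancel (chart_lift E f g phi) (chart_lift E f g phi').
Proof.
move=> [_ [_ _ Eg gf fg]] pK y.
have [Ey|nEy] := pselect (E y); last by rewrite !chart_lift_out.
by rewrite (chart_lift_in _ _ phi Ey) chart_lift_in// fg pK gf.
Qed.

(** On [E] the map is a composite. Off [E] it is the identity near [y], because the image of the
    closed unit ball is compact, hence closed in a Hausdorff space. *)
Lemma chart_lift_continuous E f g phi : hausdorff_space X -> chart E f g ->
  continuous phi -> (forall v, 1 <= `|v| -> phi v = v) ->
  continuous (chart_lift E f g phi).
Proof.
move=> hX cE cphi phi1 y; have [cg [oE cf Eg gf fg]] := cE.
have [Ey|nEy] := pselect (E y).
  have near_eq : \forall z \near y, g (phi (f z)) = chart_lift E f g phi z.
    apply: filterS (open_nbhs_nbhs (conj oE Ey)) => z Ez.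
    by rewrite chart_lift_in.
  apply: cvg_trans (near_eq_cvg near_eq) _.
  rewrite chart_lift_in//.
  have H : {for f y, continuous (g \o phi)}.
    by apply: continuous_comp; [exact: cphi|exact: cg].
  exact: (@continuous_comp _ _ _ f (g \o phi) y (cf y Ey) H).
pose B : set V := [set v | `|v| <= 1].
have cB : closed (g @` B).
  apply: compact_closed => //; apply: continuous_compact.
    by apply: continuous_subspaceT.
  apply: bounded_closed_compact.
    exists 1; split; first exact: num_real.
    by move=> M M1 v vB; apply: le_trans vB (ltW M1).
  have -> : B = closed_ball_ Num.Def.normr (0 : V) 1.
    by apply/seteqP; split=> v; rewrite /B /closed_ball_/= sub0r normrN.
  exact: closed_closed_ball_.
have nBy : (~` (g @` B)) y by move=> [v _ gv]; apply: nEy; rewrite -gv.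
have near_eq : \forall z \near y, z = chart_lift E f g phi z.
  apply: filterS (open_nbhs_nbhs (conj (closed_openC cB) nBy)) => z Bz.
  by rewrite (chart_lift_far cE).
apply: cvg_trans (near_eq_cvg near_eq) _.
by rewrite chart_lift_out//; exact: cvg_id.
Qed.

Definition chart_shrink E f g k := chart_lift E f g (shrink k).

Lemma chart_shrink_Homeo E f g W k : hausdorff_space X -> chart E f g ->
  (forall v, `|v| <= 1 -> W (g v)) ->
  Homeo W (chart_shrink E f g k : {compact-open, X -> X}).
Proof.
move=> hX cE gW; split; last first.
  move=> x nWx; apply: chart_lift_far => //; first exact: shrink_far.
  by move=> [v v1 gv]; apply: nWx; rewrite -gv; exact: gW.
split.
  apply: chart_lift_continuous => //; first exact: shrink_continuous.
  exact: shrink_far.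
exists (chart_lift E f g (unshrink k)); split.
- apply: chart_lift_continuous => //; first exact: unshrink_continuous.
  exact: unshrink_far.
- by apply: chart_liftK => //; exact: shrinkK.
- by apply: chart_liftK => //; exact: unshrinkK.
Qed.

Lemma chart_shrink_cvg E f g v : chart E f g -> `|v| < 1 ->
  chart_shrink E f g k (g v) @[k --> \oo] --> g 0.
Proof.
move=> [cg [_ _ Eg _ fg]] v1.
have -> : (fun k => chart_shrink E f g k (g v)) = g \o (fun k => shrink k v).
  by apply/funext => k; rewrite /chart_shrink chart_lift_in// fg.
by apply: continuous_cvg; [exact: cg|exact: shrink_cvg0].
Qed.

End Charts.

(** * Failure of local compactness at a chart of positive dimension *)

Section NotLocallyCompact.
Context {X : topologicalType}.
Hypothesis hX : hausdorff_space X.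

(** The nonzero vector [w] encodes positive dimension: it supplies two points that a cluster point
    of the shrinking maps would identify. *)
Lemma chart_not_loc_compact (n : nat) (E U : set X) (f : X -> 'rV[R]_n)
    (g : 'rV[R]_n -> X) (x : X) (w : 'rV[R]_n) :
  w != 0 -> chart E f g -> E x -> nbhs x U -> ~ loc_compact_in (Homeo U).
Proof.
move=> w0 cE Ex xU lc.
have [N [cN NU [V [oV Vid VN]]]] := lc _ (Homeo_id U).
have [W xW WV] := compact_open_supported hX x (open_nbhs_nbhs (conj oV Vid)).
have [f' [g' [cE' gW]]] := chart_rescale cE Ex (filterI xW xU).
pose h k : {compact-open, X -> X} := chart_shrink E f' g' k.
have hN k : N (h k).
  have hWU := chart_shrink_Homeo k hX cE' gW.
  have hW : Homeo W (h k) by apply: Homeo_subset hWU => ? [].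
  have hU : Homeo U (h k) by apply: Homeo_subset hWU => ? [].
  apply: VN; split=> //; apply: WV; first exact: hW.2.
  by move=> y; exact: Homeo_stable hW.
have hooN : (h @ \oo) N by exists 0%N => // k _; exact: hN.
have [p [Np clp]] := cN _ _ hooN.
(* Evaluation is continuous, so [p (g' v)] is a cluster point of a sequence converging to [g' 0];
   Hausdorff separation makes the two equal. *)
have pE v : `|v| < 1 -> p (g' v) = g' 0.
  move=> v1; apply: hX => A B pA gB.
  have hB : \forall k \near \oo, B (h k (g' v)) by exact: (chart_shrink_cvg cE' v1 gB).
  have hooB : (h @ \oo) [set q | B (q (g' v))] by exact: hB.
  have [q [qA qB]] := clp _ _ hooB (compact_open_eval pA).
  by exists (q (g' v)).
(* This multiple of [w] has norm 1/2. *)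
have w1 : `|(2 * `|w|)^-1 *: w| < 1.
  rewrite normrZ gtr0_norm ?invr_gt0 ?mulr_gt0 ?normr_gt0//.
  by rewrite invfM -mulrA mulVf ?normr_eq0//; lra.
have w2 : (2 * `|w|)^-1 *: w != 0.
  by rewrite scaler_eq0 negb_or w0 andbT invr_eq0 mulf_neq0// normr_eq0.
have pw := pE _ w1; rewrite -(pE 0) ?normr0// in pw.
have {}pw := Homeo_inj (NU _ Np) pw.
have [_ [_ _ _ _ fg]] := cE'.
by move: w2; rewrite -(fg (_ *: w)) pw fg eqxx.
Qed.

Lemma locally_euclidean_not_loc_compact (U : set X) :
  @locally_euclidean X -> (forall x : X, ~ isolated_point x) ->
  open U -> U !=set0 -> ~ loc_compact_in (Homeo (closure U)).
Proof.
move=> leX niX oU [x Ux]; have [E [oE [Ex [n [f [g [cf cg Eg gf fg]]]]]]] := leX x.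
have cE : chart E f g.
  split=> //; split=> // y Ey.
  by move: cf; rewrite continuous_open_subspace// => /(_ y (mem_set Ey)).
have xU : nbhs x (closure U).
  by apply: filterS (open_nbhs_nbhs (conj oU Ux)); exact: subset_closure.
(* In dimension 0 the chart domain is a single open point, against [niX]. *)
case: n f g cf cg Eg gf fg cE => [|n] f g cf cg Eg gf fg cE.
  exfalso; apply: (niX x); rewrite /isolated_point.
  rewrite (_ : [set x] = E)//; apply/seteqP; split=> y; first by move=> ->.
  by move=> Ey; rewrite -(gf y Ey) -(gf x Ex) /= (thinmx0 (f y)) (thinmx0 (f x)).
apply: (@chart_not_loc_compact _ E _ f g x (const_mx 1)) => //.
by apply/eqP => /matrixP/(_ ord0 ord0); rewrite !mxE => /eqP; rewrite oner_eq0.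
Qed.

End NotLocallyCompact.

(** * Closed discrete sequences and metrization *)

Section ClosedDiscrete.
Context {X : topologicalType}.
Hypothesis hX : hausdorff_space X.
Implicit Types (A T : set X) (t : nat -> X).

Lemma hausdorff_finite_closed (s : set X) : finite_set s -> closed s.
Proof.
by have /accessible_finite_set_closed := hausdorff_accessible hX; apply.
Qed.

(** Some neighbourhood of [x] misses all terms of large index; the finitely many other terms
    different from [x] form a closed set, which is removed. *)
Lemma escapes_isolate t (x : X) : escapes t setT ->
  exists V, [/\ open V, V x & forall n, V (t n) -> t n = x].
Proof.
move=> /(_ x I)[[U D] [/= xU [N _ ND]] UD].
move: xU; rewrite nbhsE => -[U' [oU' U'x] U'U].
exists (U' `&` ~` ((t @` `I_N) `\ x)); split.
- apply: openI => //; apply: closed_openC; apply: hausdorff_finite_closed.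
  by apply: finite_setD; apply: finite_image; exact: finite_II.
- by split=> // -[_ /(_ erefl)].
move=> n [/U'U Utn ntn]; have [Nn|nN] := leqP N n.
  by have := UD (t n, n) (conj Utn (ND n Nn)).
by apply: contrapT => nx; apply: ntn; split=> //; exists n.
Qed.

(** A finite range would be compact, and an escaping sequence eventually leaves every compact
    set. *)
Lemma escapes_range_infinite t : escapes t setT -> infinite_set (range t).
Proof.
move=> te fin; have cpt : compact (range t) by exact: finite_compact.
have [N _ NP] : \forall n \near \oo, ~ range t (t n).
  by apply: escapes_compact cpt => x _; exact: te.
by apply: (NP N (leqnn N)); exists N.
Qed.

Lemma escapes_range_discrete t : escapes t setT -> discrete_set (range t).
Proof.
move=> te _ [n _ <-]; have [V [oV Vx Vt]] := escapes_isolate (t n) te.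
exists V; split=> //; apply/seteqP; split=> [y [Vy [m _ tm]]|_ ->].
  by rewrite -tm; apply: Vt; rewrite tm.
by split=> //; exists n.
Qed.

Lemma escapes_range_closed t : escapes t setT -> closed (range t).
Proof.
move=> te x clx; have [V [oV Vx Vt]] := escapes_isolate x te.
have [_ [[n _ <-] Vn]] := clx V (open_nbhs_nbhs (conj oV Vx)).
by exists n => //; exact: Vt.
Qed.

(** At a point off [T] the complement of [T] works. At a point of [T] an isolating neighbourhood
    contains [t n] for at most one [n], by injectivity. *)
Lemma closed_discrete_escapes T t : closed T -> discrete_set T ->
  injective t -> (forall n, T (t n)) -> escapes t setT.
Proof.
move=> cT dT ti tT x _; have [Tx|nTx] := pselect (T x); last first.
  exists (~` T, setT); last by move=> [y n] [/= nTy _] tny; apply: nTy; rewrite -tny.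
  by split; [apply: open_nbhs_nbhs; split=> //; exact: closed_openC|exact: filterT].
have [V [oV VT]] := dT x Tx.
have Vx : V x by have [] : (V `&` T) x by rewrite VT.
have [[m mx]|nm] := pselect (exists m, t m = x); last first.
  exists (V, setT); first by split; [exact: open_nbhs_nbhs|exact: filterT].
  move=> [y n] [/= Vy _] tny; apply: nm; exists n.
  have : (V `&` T) (t n) by split; rewrite ?tny// -tny.
  by rewrite VT.
exists (V, [set n | (m < n)%N]); first by split; [exact: open_nbhs_nbhs|exists m.+1].
move=> [y n] [/= Vy mn] tny.
have : (V `&` T) (t n) by split; [rewrite tny|exact: tT].
by rewrite VT /= -mx => /ti nm; rewrite nm ltnn in mn.
Qed.

Lemma infinite_escapes T : infinite_set T -> discrete_set T -> closed T ->
  exists t, [/\ injective t, (forall n, T (t n)) & escapes t setT].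
Proof.
move=> /infiniteP/card_leP[f] dT cT.
pose t n := set_val (f (to_setT n)).
have ti : injective t.
  move=> m n /val_inj/(@inj _ _ _ f); rewrite !in_setT => /(_ isT isT).
  exact: (congr1 set_val).
have tT n : T (t n) by exact: set_valP.
by exists t; split=> //; exact: closed_discrete_escapes cT dT ti tT.
Qed.

End ClosedDiscrete.

(** * Gluing metrics by functions *)

Section Glue.
Context {X : topologicalType}.

Lemma near_forall_ltn (T : Type) (F : set_system T) (P : nat -> set T) N : Filter F ->
  (forall i, \forall y \near F, P i y) ->
  \forall y \near F, forall i, (i < N)%N -> P i y.
Proof.
move=> FF PF; elim: N => [|N IH]; first exact: nearW.
apply: filterS (filterI IH (PF N)) => y [yN PN] i.
by rewrite ltnS leq_eqVlt => /orP[/eqP->|/yN].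
Qed.

(* The metric is the supremum over [i] and [p] of the oscillations of [phi i] and of
   [x |-> phi i x * d_i(x, p)], extended by zero outside [K i]. *)
Lemma metrizable_on_glue (A : set X) (K : nat -> set X) (phi : nat -> X -> R) :
  (forall i, metrizable_on (K i)) ->
  (forall i x, A x -> 0 <= phi i x <= 1) ->
  (forall i x e, A x -> 0 < e -> \forall y \near x, A y -> `|phi i x - phi i y| < e) ->
  (forall i x, A x -> 0 < phi i x -> K i x) ->
  (forall x, A x -> exists i, 0 < phi i x) ->
  metrizable_on A.
Proof.
move=> Km phi01 phic phiK phix.
have /choice[d dP] : forall i, exists d, metric_on (K i) d /\ forall x y, d x y <= 1.
  by move=> i; have [d dK d1] := metrizable_on_bounded (Km i); exists d.
pose G (j : nat * option X) x : R :=
  if j.2 is Some p then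
    if `[< K j.1 p /\ K j.1 x >] then phi j.1 x * d j.1 x p else 0
  else phi j.1 x.
have G01 j x : A x -> 0 <= G j x <= phi j.1 x.
  case: j => i [p|] Ax; have := phi01 i x Ax; rewrite /G/=; last by move=> /andP[-> _] /=.
  case: asboolP => [[Kp Kx]|_] /andP[p0 p1]; last by rewrite lexx.
  have [[d0 _ _ _ _] d1] := dP i.
  by rewrite mulr_ge0 ?d0//= ler_piMr.
have w0 i : 0 < i.+1%:R^-1 :> R by rewrite invr_gt0.
have w1 i : i.+1%:R^-1 <= 1 :> R by rewrite invf_le1 ?ler1n.
(* The weights 1/(i+1) leave only finitely many [i] to control at a given precision. *)
apply: (@metrizable_on_family _ _ _ (fun j x => j.1.+1%:R^-1 * G j x)).
- move=> j x Ax; have /andP[G0 G1] := G01 j x Ax.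
  have /andP[p0 p1] := phi01 j.1 x Ax.
  apply/andP; split; first by apply: mulr_ge0 => //; exact: ltW.
  by apply: mulr_ile1 => //; exact: le_trans G1 p1.
- move=> x e Ax e0.
  have [N _ NP] := near_infty_natSinv_lt (PosNum e0).
  have Gi i : \forall y \near x, A y -> forall o, `|G (i, o) x - G (i, o) y| <= e.
    have /andP[p0 p1] := phi01 i x Ax.
    (* If [phi i x] vanishes, so do all coordinates of index [i] at [x], and at [y] they are at most
       [phi i y]. *)
    have [px|px] := leP (phi i x) 0.
      apply: filterS (phic i x e Ax e0) => y H Ay o.
      have /andP[Gx0 Gx1] := G01 (i, o) x Ax; have /andP[Gy0 Gy1] := G01 (i, o) y Ay.
      by have := H Ay; rewrite !(ler_norml, ltr_norml) /= in Gx1 Gy1 * => ?; lra.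
    (* The bound [phi i x] keeps [phi i y] positive, so that [y] stays in [K i]. *)
    have e2 : 0 < Num.min (e / 2) (phi i x) by rewrite lt_min px divr_gt0.
    have e3 : 0 < e / 2 by rewrite divr_gt0.
    have [dK d1] := dP i; have [d0 _ ds dt _] := dK.
    have Kx := phiK i x Ax px.
    apply: filterS (filterI (phic i x _ Ax e2) (metric_on_near dK Kx e3)).
    move=> y [H1 H2] Ay; have := H1 Ay; rewrite lt_min => /andP[h1 h2].
    have py : 0 < phi i y by rewrite ltr_norml in h2; lra.
    have Ky := phiK i y Ay py; have xy := H2 Ky.
    move=> [p|]; rewrite /G/=; last by lra.
    have [Kp|nKp] := pselect (K i p); last first.
      by rewrite !asboolF ?subrr ?normr0; [lra|case|case].
    rewrite !asboolT//.
    have -> : phi i x * d i x p - phi i y * d i y p =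
      (phi i x - phi i y) * d i x p + phi i y * (d i x p - d i y p) by lra.
    apply: le_trans (ler_normD _ _) _; rewrite !normrM (splitr e) lerD//.
      apply: le_trans (ltW h1); rewrite ler_piMr// ger0_norm ?d0//.
    have /andP[_ py1] := phi01 i y Ay.
    apply: le_trans (ltW xy); rewrite gtr0_norm//.
    apply: (@le_trans _ _ (`|d i x p - d i y p|)); first by rewrite ler_piMl.
    have t1 := dt _ _ _ Kx Ky Kp; have t2 := dt _ _ _ Ky Kx Kp.
    by rewrite (ds y x)// in t2; rewrite ler_norml; lra.
  have : \forall y \near x, forall i, (i < N)%N ->
      A y -> forall o, `|G (i, o) x - G (i, o) y| <= e.
    exact: near_forall_ltn Gi.
  apply: filterS => y H Ay [i o] /=.
  have /andP[Gx0 Gx1] := G01 (i, o) x Ax; have /andP[Gy0 Gy1] := G01 (i, o) y Ay.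
  have /andP[px0 px1] := phi01 i x Ax; have /andP[py0 py1] := phi01 i y Ay.
  rewrite -mulrBr normrM gtr0_norm//; have [iN|Ni] := ltnP i N.
    apply: le_trans (H i iN Ay o); rewrite ler_piMl//.
  apply: le_trans (ltW (NP i Ni)); apply: ler_piMr; first exact: ltW.
  by rewrite /= in Gx1 Gy1; rewrite ler_norml; lra.
- move=> x W Ax xW; have [i px] := phix x Ax; have Kx := phiK i x Ax px.
  have [dK d1] := dP i; have [d0 _ ds dt _] := dK.
  have [e e0 eW] := metric_on_ball dK Kx xW.
  (* The [None] coordinate forces [phi i y > c], hence [y] is in [K i]; the [Some x] coordinate of
     [y] is then at least [c * d i x y]. *)
  pose c := phi i x / 2; have c0 : 0 < c by rewrite divr_gt0.
  exists (i.+1%:R^-1 * Num.min c (c * e)).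
    by rewrite mulr_gt0// lt_min c0 mulr_gt0.
  move=> y Ay H.
  have {}H o : `|G (i, o) x - G (i, o) y| < c /\ `|G (i, o) x - G (i, o) y| < c * e.
    apply/andP; rewrite -lt_min -(ltr_pM2l (w0 i)).
    by have := H (i, o); rewrite /= -mulrBr normrM gtr0_norm.
  have [h1 _] := H None; rewrite /G/= ltr_norml in h1.
  have py : c < phi i y by rewrite /c; rewrite /c in h1; lra.
  have Ky : K i y by apply: phiK => //; lra.
  apply: eW => //; have [_] := H (Some x); rewrite /G/= !asboolT//.
  rewrite (metric_on_xx dK Kx) mulr0 sub0r normrN ds// => h2.
  rewrite -(ltr_pM2l c0); apply: le_lt_trans h2.
  apply: le_trans (ler_norm _); rewrite ler_wpM2r ?d0//; exact: ltW.
- move=> x y Ax Ay H; have [i px] := phix x Ax; have Kx := phiK i x Ax px.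
  have [dK d1] := dP i; have [_ dd _ _ _] := dK.
  have {}H o : G (i, o) x = G (i, o) y.
    by have := H (i, o) => /= /mulfI; apply; rewrite gt_eqF.
  have pxy : phi i x = phi i y := H None.
  have Ky : K i y by apply: phiK => //; rewrite -pxy.
  have := H (Some x); rewrite /G/= !asboolT// (metric_on_xx dK Kx) mulr0.
  by move=> /esym/eqP; rewrite -pxy mulf_eq0 gt_eqF//= => /eqP/dd ->.
Qed.

End Glue.

(** * Metrization of compact sets and of unions of discrete families *)

Section Metrization.
Context {X : topologicalType}.
Hypothesis hX : hausdorff_space X.

(** Near-covering is applied to the filter of finite lists directed by inclusion. *)
Lemma compact_nbhs_subcover (M : set X) (U : X -> set X) :
  compact M -> (forall x, M x -> nbhs x (U x)) ->
  exists s : seq X, forall y, M y -> exists2 x, x \in s & U x y.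
Proof.
move=> /compact_near_coveringP cM MU.
pose F : set_system (seq X) :=
  filter_from setT (fun s : seq X => [set s' : seq X | {subset s <= s'}]).
have FF : Filter F.
  apply: filter_from_filter; first by exists [::].
  move=> s1 s2 _ _; exists (s1 ++ s2) => // s H.
  by split=> x xs; apply: H; rewrite mem_cat xs ?orbT.
have [|s _ sP] := cM _ F (fun s y => exists2 x, x \in s & U x y) FF.
  move=> x Mx; exists (U x, [set s' : seq X | {subset [:: x] <= s'}]).
    by split=> /=; [exact: MU|exists [:: x]].
  by move=> [y s] /= [Uy xs]; exists x => //; apply: xs; rewrite inE.
by exists s; apply: (sP s).
Qed.

(** Finitely many Urysohn functions, each positive only inside a metrizable neighbourhood, have no
    common zero on [M], so the metrics glue. *)
Lemma compact_metrizable_on (M : set X) :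
  normal_space X -> @locally_metrizable X -> compact M -> metrizable_on M.
Proof.
move=> nX lmX cM.
have [[x0 Mx0]|M0] := pselect (exists x, M x); last first.
  exists (fun _ _ => 0).
  by apply: metric_onI => x; move=> *; exfalso; apply: M0; exists x.
have /choice[N NP] := lmX.
have /choice[phi phiP] : forall x, exists phi : X -> R, [/\ continuous phi,
    (forall y, 0 <= phi y <= 1), 0 < phi x & forall y, 0 < phi y -> N x y].
  move=> x; have [xN _] := NP x.
  have sep : uniform_separator [set x] (~` (N x)°).
    apply: (@normal_completely_regular R) => //; first exact: hausdorff_accessible.
    exact: open_closedC (open_interior _).
  have [f [cf f01 fx fN]] := (@uniform_separatorP _ R _ _).1 sep.
  (* The separating function is 0 at [x] and 1 off the interior of [N x], hence the reversal. *)
  exists (fun y => 1 - f y); split.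
  - move=> y; apply: (@cvgB R R^o); [exact: cvg_cst|exact: cf].
  - move=> y; have : `[0, 1]%classic (f y) by apply: f01; exists y.
    by rewrite /= in_itv/= => /andP[? ?]; lra.
  - have -> : f x = 0 by apply: fx; exists x.
    by rewrite subr0 ltr01.
  - move=> y fy; apply: contrapT => nNy.
    have : f y = 1 by apply: fN; exists y => // /interior_subset.
    by move=> fy1; rewrite fy1 subrr ltxx in fy.
have [|s sP] := @compact_nbhs_subcover M (fun x => phi x @^-1` [set r | 0 < r]) cM.
  move=> x Mx; have [cphi _ px _] := phiP x; apply: cphi.
  by apply: open_nbhs_nbhs; split=> //; exact: open_gt.
(* Past the end of [s] the default [x0] only repeats one metrizable piece. *)
apply: (@metrizable_on_glue _ M (fun i => N (nth x0 s i)) (fun i => phi (nth x0 s i))).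
- by move=> i; have [_] := NP (nth x0 s i).
- by move=> i x _; have [_ + _ _] := phiP (nth x0 s i); exact.
- move=> i x e _ e0; have [cphi _ _ _] := phiP (nth x0 s i).
  have H : nbhs x (phi (nth x0 s i) @^-1` ball (phi (nth x0 s i) x) e).
    by apply: cphi; exact: nbhsx_ballx.
  by apply: filterS H => y Hy _.
- by move=> i x _; have [_ _ _ +] := phiP (nth x0 s i); exact.
- move=> x /sP[y ys yx]; exists (index y s).
  by rewrite nth_index.
Qed.

Hypothesis lcX : loc_compact_in [set: X].

(** Removing the earlier closed sets [C m] makes the open sets [H n] disjoint, and normality gives a
    neighbourhood [W] of the sequence whose closure lies in their union [U]. With [D n] inside both
    [H n] and [W], a point of [U] has some [H m] as the required neighbourhood, and any other point
    has the complement of the closure of [W]. *)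
Lemma normal_discrete_family (t : nat -> X) (B : nat -> set X) :
  normal_space X -> injective t -> escapes t setT ->
  (forall n, nbhs (t n) (B n)) ->
  exists D : nat -> set X,
    (forall n, [/\ nbhs (t n) (D n), compact (D n), closed (D n) & D n `<=` B n]) /\
    forall x : X, exists2 V, nbhs x V & exists m, forall n y, V y -> D n y -> n = m.
Proof.
move=> nX ti te tB.
have /choice[C CP] : forall n, exists C, [/\ nbhs (t n) C, closed C &
    forall m, C (t m) -> m = n].
  move=> n; have [V [oV Vx Vt]] := escapes_isolate hX (t n) te.
  have [C [tC _ cC CV]] := compact_nbhs_inside hX lcX (open_nbhs_nbhs (conj oV Vx)).
  by exists C; split=> // m /CV/Vt/ti.
pose H n := (C n)° `&` \bigcap_(m in `I_n) (~` C m).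
have oH n : open (H n).
  apply: openI; first exact: open_interior.
  rewrite bigcap_mkord; apply: (big_ind open); first exact: openT.
    by move=> *; exact: openI.
  by move=> i _; apply: closed_openC; have [] := CP i.
have Ht n : H n (t n).
  by have [tC _ Ct] := CP n; split=> // m /= mn Cm; have [_ _ /(_ _ Cm) nm] := CP m;
    rewrite nm ltnn in mn.
have Hdisj n m x : H n x -> H m x -> n = m.
  wlog : n m / (n < m)%N.
    move=> W Hn Hm; have [nm|mn|//] := ltngtP n m; first exact: W.
    by apply/esym; exact: W.
  by move=> nm [/interior_subset Cn _] [_ /(_ n nm)].
pose U := \bigcup_n H n.
have oU : open U by apply: bigcup_open.
have TU : set_nbhs (range t) U.
  move=> _ [n _ <-]; apply: open_nbhs_nbhs; split=> //.
  by exists n.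
have [W TW WU] := nX _ (escapes_range_closed hX te) _ TU.
have /choice[D DP] : forall n, exists D, [/\ nbhs (t n) D, compact D, closed D &
    D `<=` H n `&` W `&` B n].
  move=> n; apply: compact_nbhs_inside => //.
  apply: filterI => //; apply: filterI; last by apply: TW; exists n.
  by apply: open_nbhs_nbhs; split.
exists D; split; first by move=> n; have [? ? ? DB] := DP n; split=> // y /DB[].
move=> x; have [[m _ Hmx]|nUx] := pselect (U x).
  exists (H m); first exact: open_nbhs_nbhs.
  exists m => n y Hmy Dny; have [_ _ _ /(_ _ Dny)[[Hny _] _]] := DP n.
  exact: Hdisj Hny Hmy.
exists (~` closure W).
  apply: open_nbhs_nbhs; split; first by apply: closed_openC; exact: closed_closure.
  by move=> /WU.
exists 0%N => n y nWy Dny; have [_ _ _ /(_ _ Dny)[[_ Wy] _]] := DP n.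
by exfalso; apply: nWy; exact: subset_closure.
Qed.

(** The set is the union of the closures of the interiors of a discrete family; discreteness makes
    this union closed. *)
Lemma metrizable_regular_closed (t : nat -> X) :
  normal_space X -> @locally_metrizable X -> injective t -> escapes t setT ->
  exists A : set X, [/\ regular_closed A, sigma_compact A, metrizable_on A &
    range t `<=` interior A].
Proof.
move=> nX lmX ti te.
have /choice[B BP] : forall n, exists B, nbhs (t n) B /\ metrizable_on B.
  by move=> n; exact: lmX.
have [D [DP Dd]] := normal_discrete_family nX ti te (fun n => (BP n).1).
pose A_ n := closure (D n)°.
have AD n : A_ n `<=` D n.
  have [_ _ cD _] := DP n; rewrite /A_ [X in _ `<=` X](closure_id _).1//.
  exact: closureS (@interior_subset _ _).
have cA n : compact (A_ n).
  have [_ kD _ _] := DP n; apply: subclosed_compact kD (AD n).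
  exact: closed_closure.
have iA n : (D n)° `<=` (\bigcup_k A_ k)°.
  rewrite -open_subsetE; last exact: open_interior.
  by move=> y Dy; exists n => //; exact: subset_closure.
exists (\bigcup_n A_ n); split.
- apply/seteqP; split; last first.
    by move=> x [n _ Ax]; exact: (closureS (iA n) Ax).
  have clA : closed (\bigcup_n A_ n).
    move=> x clx; have [V xV [m Vm]] := Dd x.
    suff Amx : A_ m x by exists m.
    apply: (@closed_closure _ (D m)°) => W xW.
    have [y [[n _ Any] [Vy Wy]]] := clx _ (filterI xV xW).
    by exists y; split=> //; rewrite -(Vm n y Vy (AD _ _ Any)).
  by rewrite [X in _ `<=` X](closure_id _).1//; exact: closureS (@interior_subset _ _).
- by exists A_.
(* The indicators of the [A_ n] are locally constant on the union, again by discreteness. *)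
- apply: (@metrizable_on_glue _ _ A_ (fun n y => if `[< A_ n y >] then 1 else 0)).
  + move=> n; have [_ mB] := BP n; have [_ _ _ DB] := DP n.
    by apply: metrizable_on_subset mB => y /AD/DB.
  + by move=> n x _; case: ifP => _; rewrite ?lexx ler01.
  + move=> n x e [k _ Akx] e0; have [V xV [m Vm]] := Dd x.
    have Vx := nbhs_singleton xV; have km : k = m := Vm _ _ Vx (AD _ _ Akx).
    apply: filterS xV => y Vy [l _ Aly].
    have lm : l = m := Vm _ _ Vy (AD _ _ Aly).
    rewrite (_ : `[< A_ n x >] = `[< A_ n y >]) ?subrr ?normr0//.
    apply: asbool_equiv_eq; split=> [Ax|Ay].
      by rewrite (Vm _ _ Vx (AD _ _ Ax)) -lm.
    by rewrite (Vm _ _ Vy (AD _ _ Ay)) -km.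
  + by move=> n x _; case: asboolP => // _; rewrite ltxx.
  + by move=> x [n _ Ax]; exists n; rewrite asboolT// ltr01.
- by move=> _ [n _ <-]; apply: (iA n); have [tD _ _ _] := DP n; exact: tD.
Qed.

(** A point isolated in [S] is its own compact neighbourhood in [S']. Hence failure of local
    compactness for a smaller support rules out discreteness for a larger one. *)
Lemma discrete_in_loc_compact (S S' : set {compact-open, X -> X}) :
  S' `<=` S -> discrete_in S -> loc_compact_in S'.
Proof.
move=> SS dS y S'y; exists [set y]; split; first exact: compact_set1.
  by move=> _ ->.
have [V [oV VS]] := dS y (SS _ S'y); exists V; split=> //.
  by have [] : (V `&` S) y by rewrite VS.
by move=> z [Vz /SS Sz]; rewrite -VS.
Qed.

End Metrization.

(** * Failure of the algebraic colimit property *)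

(** At a point without compact neighbourhoods all closed balls are non-compact. A sequence escaping
    in such a ball escapes in [S] too, because the ball is closed in [S]. *)
Lemma not_loc_compact_escapes (Y : topologicalType) (S : set Y) (d : Y -> Y -> R) :
  metric_on S d -> ~ loc_compact_in S ->
  exists2 y, S y & forall e, 0 < e -> exists z : nat -> Y,
    [/\ forall k, S (z k), forall k, d y (z k) <= e & escapes z S].
Proof.
move=> dS /existsNP[y /not_implyP[Sy ny]]; exists y => // e e0.
have [_ _ ds dt _] := dS.
pose B := [set z | S z /\ d y z <= e].
have BS : B `<=` S by move=> z [].
have ncB : ~ compact B.
  move=> cB; apply: ny; exists B; split=> //.
  have : nbhs y [set z | S z -> d y z < e] by exact: metric_on_near.
  rewrite nbhsE => -[V [oV Vy] Ve]; exists V; split=> // z [Vz Sz]; split=> //.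
  by apply: ltW; exact: Ve.
have [z zB zesc] := noncompact_escapes (ex_intro _ d (metric_on_subset BS dS)) ncB.
exists z; split; [by move=> k; case: (zB k)|by move=> k; case: (zB k)|].
move=> x Sx; have [Bx|nBx] := pselect (B x); first exact: zesc.
have yx : 0 < d y x - e.
  by rewrite subr_gt0 ltNge; apply/negP => yx; apply: nBx.
exists ([set w | S w -> d x w < d y x - e], setT).
  by split; [exact: metric_on_near|exact: filterT].
move=> [w k] [/= wS _] zw; have [Sz yz] := zB k; rewrite zw in Sz yz.
have xw := wS Sz; have := dt y w x Sy Sz Sx; rewrite (ds w x)// => tri.
by move: xw yz tri; rewrite ltrBrDl => h1 h2 /le_lt_trans/(_ (le_lt_trans _ h1));
  rewrite lerD2r h2 ltxx => /(_ isT).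
Qed.

Section NotACP.
Context {X : topologicalType}.
Hypothesis hX : hausdorff_space X.
Hypothesis lcX : loc_compact_in [set: X].
Implicit Types (D K M : set X).

(** A non-isolated [f] is approximated by maps [g k] different from [f]; composing with the inverse
    of [f] on the left moves the limit to the identity. *)
Lemma nondiscrete_cvg_id D : compact D -> metrizable_on D ->
  ~ discrete_in (Homeo D) ->
  exists y : nat -> {compact-open, X -> X},
    [/\ forall k, Homeo D (y k), forall k, exists x, y k x <> x &
        y @ \oo --> (id : {compact-open, X -> X})].
Proof.
move=> cD mD /existsNP[f /not_implyP[fD nf]].
have [d dH] := metrizable_on_Homeo hX lcX cD mD.
have /choice[g gP] : forall k : nat, exists g : {compact-open, X -> X},
    [/\ Homeo D g, g <> f & d f g < k.+1%:R^-1].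
  move=> k; apply: contrapT => ng; apply: nf.
  have k0 : 0 < k.+1%:R^-1 :> R by rewrite invr_gt0.
  have : nbhs f [set g : {compact-open, X -> X} | Homeo D g -> d f g < k.+1%:R^-1].
    exact: (metric_on_near dH fD k0).
  rewrite nbhsE => -[V [oV Vf] Ve]; exists V; split=> //.
  apply/seteqP; split=> [g [Vg gD]|_ ->//].
  by apply: contrapT => gf; apply: ng; exists g; split=> //; exact: Ve.
have [f' [f'D ff' f'f]] := Homeo_inverse fD.
exists (fun k => f' \o g k); split.
- by move=> k; have [gD _ _] := gP k; exact: Homeo_comp.
- move=> k; have [_ gf _] := gP k; apply/existsNP => H; apply: gf.
  by apply/funext => x; rewrite -{2}(H x) /= f'f.
have gf : g @ \oo --> f.
  move=> W fW; have [e e0 eW] := metric_on_ball dH fD fW.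
  apply: filterS (near_infty_natSinv_lt (PosNum e0)) => k /= ke.
  by have [gD _ gk] := gP k; apply: eW => //; exact: lt_trans gk ke.
have H := compact_open_comp_cvg _ (Homeo_continuous f'D) gf.
have idE : (f' \o f : {compact-open, X -> X}) = id by apply/funext => x; exact: ff'.
by rewrite idE in H; exact: H.
Qed.

Lemma disjoint_supports M D (z y : {compact-open, X -> X}) x : Homeo M z -> Homeo D y ->
  (forall u, D u -> ~ M u) -> ~ M x -> z (y x) = y x.
Proof.
move=> zM yD DM nMx; apply: zM.2; have [Dx|nDx] := pselect (D x).
  by apply: DM; exact: (Homeo_stable yD Dx).
by rewrite yD.2.
Qed.

(** If [g] moves some [x] outside [M], then [z k (y k x) = y k x] tends to [x], which differs from
    [g x]. Otherwise [g] lies in [Homeo M], and forgetting what happens off [M] turns [z k \o y k]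
    back into [z k], which escapes. *)
Lemma escapes_comp M D (z y : nat -> {compact-open, X -> X}) :
  (forall u, D u -> ~ M u) -> closed M ->
  (forall k, Homeo M (z k)) -> escapes z (Homeo M) ->
  (forall k, Homeo D (y k)) -> y @ \oo --> (id : {compact-open, X -> X}) ->
  escapes (fun k => z k \o y k : {compact-open, X -> X})
    [set g : {compact-open, X -> X} | homeomorphism g].
Proof.
move=> DM cM zM zesc yD yid g hg.
have [[x [nMx gx]]|H] := pselect (exists x, ~ M x /\ g x <> x).
  have [[V1 V2] [/= V1g V2x] [oV1 oV2 V12]] :
      exists2 AB, g x \in AB.1 /\ x \in AB.2 &
        [/\ open AB.1, open AB.2 & AB.1 `&` AB.2 == set0].
    by move: hX; rewrite open_hausdorff; apply; exact/eqP.
  rewrite !inE in V1g V2x.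
  exists ([set h | V1 (h x)], [set k | V2 (y k x)]).
    split; first by apply: compact_open_eval; exact: open_nbhs_nbhs.
    suff : (y @ \oo) [set h : {compact-open, X -> X} | V2 (h x)] by [].
    by apply: yid; apply: (@compact_open_eval X id x); exact: open_nbhs_nbhs.
  move=> [h k] [/= V1h V2y] zy; have zyx : z k (y k x) = y k x.
    exact: disjoint_supports nMx.
  have : (V1 `&` V2) (y k x) by split=> //; rewrite -zyx -[z k _]/((z k \o y k) x) zy.
  by rewrite (eqP V12).
have gM : Homeo M g.
  by split=> // x nMx; apply: contrapT => gx; apply: H; exists x.
(* [r f] may be discontinuous, which is harmless: the topology lives on all functions. *)
pose r (f : {compact-open, X -> X}) : {compact-open, X -> X} :=
  fun x => if `[< M x >] then f x else x.
have rg : r @ g --> g.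
  have Fr : Filter (r @ g) by apply: fmap_filter; exact: nbhs_filter.
  apply/compact_open_cvgP => K V cK oV gKV.
  have : nbhs g [set h : {compact-open, X -> X} | h @` (K `&` M) `<=` V].
    apply: compact_open_nbhs => //; first exact: compact_closedI.
    by move=> _ [x [Kx _] <-]; apply: gKV; exists x.
  apply: (@filterS _ (nbhs g)) => h hV _ [x Kx <-]; rewrite /r.
  case: asboolP => Mx; first by apply: hV; exists x.
  by rewrite -(gM.2 x Mx); apply: gKV; exists x.
have [[V N] [/= gV NN] VN] := zesc g gM.
exists (r @^-1` V, N); first by split=> //; exact: rg.
move=> [h k] [/= Vh Nk] zy; apply: (VN (r h, k)) => //=.
apply/funext => x; rewrite -zy /r /=; case: asboolP => Mx; last by rewrite (zM k).2.
by rewrite (yD k).2// => /DM.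
Qed.

Lemma not_ACP M (D : nat -> set X) : compact M -> metrizable_on M ->
  ~ loc_compact_in (Homeo M) ->
  (forall n, [/\ compact (D n), metrizable_on (D n), (forall u, D n u -> ~ M u) &
     ~ discrete_in (Homeo (D n))]) ->
  (forall K, compact K -> \forall n \near \oo, forall x, K x -> ~ D n x) ->
  ~ @ACP X.
Proof.
move=> cM mM nlc DP Dfin [_ mulc].
have [d dH] := metrizable_on_Homeo hX lcX cM mM.
have [f fM fz] := not_loc_compact_escapes dH nlc.
have /choice[z zP] : forall n : nat, exists z : nat -> {compact-open, X -> X},
    [/\ forall k, Homeo M (z k), forall k, d f (z k) <= n.+1%:R^-1 & escapes z (Homeo M)].
  by move=> n; apply: fz; rewrite invr_gt0.
have /choice[y yP] : forall n, exists y : nat -> {compact-open, X -> X},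
    [/\ forall k, Homeo (D n) (y k), forall k, exists x, y k x <> x &
        y @ \oo --> (id : {compact-open, X -> X})].
  by move=> n; have [cD mD _ nD] := DP n; exact: nondiscrete_cvg_id.
pose F : set {compact-open, X -> X} := [set h | exists n k, h = z n k \o y n k].
(* [y n k] moves a point within [D n], and [z n k] fixes [D n] pointwise. *)
have moved n k : exists x, D n x /\ z n k (y n k x) <> x.
  have [yD ym _] := yP n; have [x yx] := ym k; have [zM _ _] := zP n.
  have [_ _ DM _] := DP n.
  have Dx : D n x by apply: contrapT => nDx; apply: yx; exact: (yD k).2.
  by exists x; split=> //; rewrite (disjoint_supports (zM k) (yD k) DM)//; exact: DM.
pose U : set {compact-open, X -> X} := HomeoC `&` ~` F.
have HC K h : compact K -> Homeo K h -> HomeoC h by move=> cK hK; exists K.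
(* A tail of the sequence avoids a neighbourhood of [g] because it escapes; each of the first [k0]
   terms differs from [g] at some point. *)
have Fn n (g : {compact-open, X -> X}) : homeomorphism g -> ~ F g ->
    \forall h \near g, forall k, z n k \o y n k <> h.
  move=> hg nFg; have [zM _ zesc] := zP n; have [yD _ yid] := yP n.
  have [_ _ DM _] := DP n.
  have [[V N] [/= gV [k0 _ k0N]] VN] :=
    escapes_comp DM (compact_closed hX cM) zM zesc yD yid hg.
  have small : \forall h \near g, forall k, (k < k0)%N -> z n k \o y n k <> h.
    apply: (@near_forall_ltn _ (nbhs g) (fun k => [set h | z n k \o y n k <> h])) => k.
    have [x gx] : exists x, g x <> z n k (y n k x).
      by apply/existsNP => gE; apply: nFg; exists n, k; apply/funext.
    have gV' : nbhs (g x) (~` [set z n k (y n k x)]).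
      apply: open_nbhs_nbhs; split=> //; apply: closed_openC.
      exact: accessible_closed_set1 (hausdorff_accessible hX) _.
    by apply: filterS (compact_open_eval gV') => h /[swap] <-; apply.
  apply: filterS (filterI gV small) => h [Vh hs] k; have [kk0|kk0] := ltnP k k0.
    exact: hs.
  by apply: (VN (h, k)); split=> //; exact: k0N.
have Uo : colim_open U.
  split=> [h []//|K cK].
  pose S : set {compact-open, X -> X} := [set h | Homeo K h -> ~ F h].
  exists S°; split; first exact: open_interior.
  apply/seteqP; split=> [g [[_ nFg] gK]|g [/interior_subset Sg gK]]; last first.
    by split=> //; split; [exact: HC gK|exact: Sg].
  (* Only indices below [N] matter: for larger [n] the product moves a point of [D n], which lies
     off [K]. *)
  split=> //; have [N _ KN] := Dfin K cK.
  have : \forall h \near g, forall n, (n < N)%N -> forall k, z n k \o y n k <> h.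
    apply: (@near_forall_ltn _ (nbhs g) (fun n => [set h | forall k, z n k \o y n k <> h])).
    by move=> n; apply: Fn => //; exact: gK.1.
  apply: filterS => h hn hK [n [k hE]]; have [nN|Nn] := ltnP n N.
    exact: (hn n nN k).
  have [x [Dx zyx]] := moved n k; apply: (KN n Nn x _ Dx).
  by apply: contrapT => nKx; apply: zyx; have := hK.2 x nKx; rewrite hE.
have nFf : ~ F f.
  move=> [n [k fE]]; have [x [Dx zyx]] := moved n k; have [_ _ DM _] := DP n.
  by apply: zyx; have := fM.2 x (DM x Dx); rewrite fE.
have [V [W [[_ oV] [_ oW] Vf Wid VW]]] :=
  mulc U Uo f id (HC _ _ cM fM) (HC _ _ (@compact0 X) (Homeo_id set0))
    (conj (HC _ _ cM fM) nFf).
have [V' [oV' VV']] := oV M cM.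
have V'f : V' f by have [] : (V' `&` Homeo M) f by rewrite -VV'.
have [e e0 eV'] := metric_on_ball dH fM (open_nbhs_nbhs (conj oV' V'f)).
(* First [n] is chosen from the neighbourhood of [f], then [k] from that of the identity in
   [Homeo (D n)]. The same [k] serves both factors, since every [z n k] is within 1/(n+1) of [f]. *)
have [n _ ne] := near_infty_natSinv_lt (PosNum e0).
have {ne} := ne n (leqnn n); rewrite /= => ne.
have [zM zf _] := zP n; have [yD _ yid] := yP n; have [cD _ _ _] := DP n.
have [W' [oW' WW']] := oW (D n) cD.
have W'id : W' id.
  by have [] : (W' `&` Homeo (D n)) id by rewrite -WW'; split=> //; exact: Homeo_id.
have [k _ kW] := yid W' (open_nbhs_nbhs (conj oW' W'id)).
have Wy : W (y n k).
  have [] // : (W `&` Homeo (D n)) (y n k).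
  by rewrite WW'; split=> //; exact: (kW k (leqnn k)).
have Vz : V (z n k).
  have [] // : (V `&` Homeo M) (z n k).
  by rewrite VV'; split=> //; apply: eV' => //; exact: le_lt_trans (zf k) ne.
by have [_] := VW _ _ Vz Wy; apply; exists n, k.
Qed.

End NotACP.

(** * Compact neighbourhoods that accumulate nowhere *)

Section SmallNeighbourhoods.
Context {X : topologicalType}.
Hypothesis hX : hausdorff_space X.
Hypothesis lcX : loc_compact_in [set: X].

(* [D n] has [d]-radius at most 1/(n+1), so a point of accumulation of the [D n] would
   be one of the sequence [t]. *)
Lemma small_nbhs_family (A M : set X) (d : X -> X -> R) (t : nat -> X) :
  metric_on A d -> closed A -> compact M -> escapes t setT ->
  (forall n, A° (t n)) ->
  exists D : nat -> set X,
    (forall n, exists m, [/\ nbhs (t m) (D n), compact (D n), closed (D n) &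
      D n `<=` A `&` ~` M]) /\
    forall K, compact K -> \forall n \near \oo, forall x, K x -> ~ D n x.
Proof.
move=> dA cA cM te tA; have [d0 _ ds dt _] := dA.
(* Starting at index [N] keeps all the centres off [M]. *)
have [N _ NM] : \forall n \near \oo, ~ M (t n).
  by apply: escapes_compact cM => x _; exact: te.
have At n : A (t n) by exact: interior_subset (tA n).
have /choice[D DP] : forall n : nat, exists D,
    [/\ nbhs (t (n + N)%N) D, compact D, closed D &
     D `<=` A° `&` ~` M `&` [set y | A y -> d (t (n + N)%N) y < n.+1%:R^-1]].
  move=> n; apply: compact_nbhs_inside => //; apply: filterI; last first.
    by apply: (metric_on_near dA (At _)); rewrite invr_gt0.
  apply: filterI; first by apply: open_nbhs_nbhs; split=> //; exact: open_interior.
  apply: open_nbhs_nbhs; split; last by apply: NM; rewrite /= leq_addl.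
  exact: closed_openC (compact_closed hX cM).
exists D; split.
  move=> n; exists (n + N)%N; have [tD kD cD DA] := DP n.
  by split=> // y /DA[[/interior_subset]].
move=> K /compact_near_coveringP cK.
apply: (cK nat \oo (fun n x => ~ D n x)) => x Kx.
have [Ax|nAx] := pselect (A x); last first.
  exists (~` A, setT).
    by split; [apply: open_nbhs_nbhs; split=> //; exact: closed_openC|exact: filterT].
  by move=> [y n] [/= nAy _] Dy; have [_ _ _ /(_ y Dy)[[/interior_subset]]] := DP n.
have [[V S] [/= xV [N0 _ N0S]] VS] := te x I.
have [e e0 eV] := metric_on_ball dA Ax xV.
have e2 : 0 < e / 2 by rewrite divr_gt0.
(* If [D n] met this ball, its centre [t (n + N)] would lie within [e] of [x], hence in [V], at an
   index beyond [N0]. *)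
exists ([set y | A y -> d x y < e / 2],
        [set n | n.+1%:R^-1 < e / 2] `&` [set n | (N0 <= n)%N]).
  split; first exact: metric_on_near.
  by apply: filterI; [exact: (near_infty_natSinv_lt (PosNum e2))|exists N0].
move=> [y n] [/= xy [ne Nn]] Dy; have [_ _ _ /(_ y Dy)[[/interior_subset Ay _] ty]] := DP n.
have dty := ty Ay; have dxy := xy Ay.
apply: (VS (t (n + N)%N, (n + N)%N)) => //=; split.
  apply: eV => //; apply: le_lt_trans (dt _ _ _ Ax Ay (At _)) _.
  by rewrite (ds y)// (splitr e) ltrD// (lt_trans dty).
by apply: N0S; rewrite /= (leq_trans Nn)// leq_addr.
Qed.

End SmallNeighbourhoods.

Theorem mainTheorem5 (X : topologicalType) :
  hausdorff_space X -> loc_compact_in [set: X] -> ~ compact [set: X] ->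
  let cond_i :=
    [/\ @metrizable X, @locally_euclidean X & forall x : X, ~ isolated_point x] in
  let cond_ii :=
    @metrizable X /\
    (forall U : set X, open U -> U !=set0 -> compact (closure U) ->
       ~ loc_compact_in (Homeo (closure U))) in
  let good_T (T : set X) :=
    [/\ infinite_set T, discrete_set T, closed T &
      forall t, T t -> forall V : set X, nbhs t V -> compact (closure V) ->
        ~ discrete_in (Homeo (closure V))] in
  let cond_iii :=
    [/\ normal_space X, @locally_metrizable X,
        (exists M0 : set X, compact M0 /\ ~ loc_compact_in (Homeo M0)) &
        (exists T : set X, good_T T)] in
  let cond_iv :=
    (exists M0 : set X,
       [/\ compact M0, metrizable_on M0 & ~ loc_compact_in (Homeo M0)]) /\
    (exists A : set X,
       [/\ regular_closed A, sigma_compact A, metrizable_on A &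
         exists T : set X, T `<=` interior A /\ good_T T]) in
  let cond_v := ~ @ACP X in
  [/\ cond_i -> cond_ii, cond_ii -> cond_iii, cond_iii -> cond_iv &
      cond_iv -> cond_v].
Proof.
move=> hX lcX ncX cond_i cond_ii good_T cond_iii cond_iv cond_v; split.
- move=> [mX leX niX]; split=> // U oU U0 _.
  exact: locally_euclidean_not_loc_compact.
- move=> [mX nlc]; have [u _ ue] := noncompact_escapes mX ncX; split.
  + exact: metrizable_normal.
  + move=> x; exists setT; split=> //; exact: filterT.
  + have [K [xK cK clK _]] := compact_nbhs_inside hX lcX (@filterT _ (nbhs (u 0%N)) _).
    have KK : closure K° `<=` K.
      by rewrite [X in _ `<=` X](closure_id _).1//; exact: closureS (@interior_subset _ _).
    have cKK : compact (closure K°).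
      by apply: subclosed_compact cK KK; exact: closed_closure.
    exists (closure K°); split=> //; apply: nlc => //; first exact: open_interior.
    by exists (u 0%N).
  + exists (range u); split; [exact: escapes_range_infinite|exact: escapes_range_discrete|
      exact: escapes_range_closed|].
    (* [V] need not be open, so the hypothesis is applied to its interior. *)
    move=> t _ V tV cV dV; have VV : closure V° `<=` closure V.
      exact: closureS (@interior_subset _ _).
    apply: (nlc V°); [exact: open_interior|by exists t| |].
      by apply: subclosed_compact cV VV; exact: closed_closure.
    exact: discrete_in_loc_compact (Homeo_subset VV) dV.
- move=> [nX lmX [M0 [cM0 nlc]] [T [iT dT cT nT]]]; split.
    by exists M0; split=> //; exact: compact_metrizable_on.
  (* [T] is replaced by the range of an injective sequence in it, whose points inherit the
     non-discreteness. *)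
  have [t [ti tT te]] := infinite_escapes iT dT cT.
  have [A [rA sA mA tA]] := metrizable_regular_closed hX lcX nX lmX ti te.
  exists A; split=> //; exists (range t); split=> //.
  split; [exact: escapes_range_infinite|exact: escapes_range_discrete|
    exact: escapes_range_closed|].
  by move=> _ [n _ <-]; apply: nT.
- move=> [[M [cM mM nlc]] [A [rA _ [d dA] [T [TA [iT dT cT nT]]]]]].
  have cA : closed A by rewrite -rA; exact: closed_closure.
  have [t [_ tT te]] := infinite_escapes iT dT cT.
  have [D [DP DK]] := small_nbhs_family hX lcX dA cA cM te (fun n => TA _ (tT n)).
  apply: (not_ACP hX lcX cM mM nlc _ DK) => n.
  have [m [tD kD cD DA]] := DP n; split=> //.
  + by exists d; apply: metric_on_subset dA => y /DA[].
  + by move=> y /DA[].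
  (* Being closed, [D n] is its own closure, so the property of [t m] applies to it. *)
  + rewrite [D n](closure_id _).1//; apply: (nT (t m)) => //.
    by rewrite -(closure_id _).1.
Qed.
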